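(* Let $(J,\beta)$ be a finite-dimensional unital pseudo-Euclidean Jordan superalgebra over $\mathbb{R}$ with positive even part. Then the underlying topological space $\mathcal{O}_0\subset J_0^*$ of a $G(J)$-orbit $\mathcal{O}$ in $J^*$ consists of elements with equal spectral signatures; that is, any two elements of $\mathcal{O}_0$ have the same spectral signature.
   Context: A superalgebra is a $\mathbb{Z}_2$-graded real (not necessarily associative) algebra $A=A_0\oplus A_1$ with $A_iA_j\subset A_{i+j}$; $|a|$ is the parity of a homogeneous $a$. $\mathrm{gl}(A)$ is a Lie superalgebra with $[f,g]=f\circ g-(-1)^{|f||g|}g\circ f$; $L_a$ is left multiplication by $a$. A Jordan superalgebra $J$ is a superalgebra with product $\{\cdot,\cdot\}$ satisfying $\{a,b\}=(-1)^{|a||b|}\{b,a\}$ and $[L_a,L_{\{b,c\}}]=[L_{\{a,b\}},L_c]-(-1)^{|a||b|}[L_b,L_{\{a,c\}}]$. $(J,\beta)$ is pseudo-Euclidean if $\beta$ is a bilinear form on $J$ that is even ($\beta(J_0,J_1)=0=\beta(J_1,J_0)$), symmetric ($\beta(a,b)=(-1)^{|a||b|}\beta(b,a)$), non-degenerate and associative ($\beta(\{a,b\},c)=\beta(a,\{b,c\})$). ''Positive even part'' means that the Jordan algebra $J_0$ is positive, i.e. $\tau(a,b)=\mathrm{tr}(L_{\{a,b\}}|_{J_0})$ is associative and positive definite on $J_0$. The structure Lie superalgebra $\mathfrak{g}(J)\subset\mathrm{gl}(J)$ is the Lie subsuperalgebra generated by all $L_a$, $a\in J$; $G(J)_0$ is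 the connected Lie group of even automorphisms of the super vector space $J$ generated by $\mathfrak{g}(J)_0$, and $G(J)=(G(J)_0,\mathfrak{g}(J))$ is the structure Lie supergroup. It acts on the dual $J^*$ (a supermanifold with underlying space $J_0^*$) by the dual action; the underlying space of the orbit through $\xi\in J_0^*$ is $\mathcal{O}_0=\{\xi\circ g: g\in G(J)_0\}\subset J_0^*$. The form $\beta$ gives $\flat:J\to J^*$, $x\mapsto x^\flat=\beta(x,\cdot)$, with inverse $\sharp$. An idempotent $e\in J_0$ is primitive if it is nonzero and not a sum of two nonzero idempotents. A Jordan frame is a collection $\{e_i\}_{i=1}^r$ of primitive idempotents in $J_0$ with $\{e_i,e_j\}=\delta_{ij}e_i$ and $\sum_i e_i=1$. Every $x\in J_0$ can be written $x=\sum_{i=1}^r\lambda_ie_i$ for some Jordan frame, with $\lambda_i\in\mathbb{R}$ unique up to permutation; these are the spectral coefficients of $x$. The spectral coefficients of $\xi\in J_0^*$ are those of $\xi^\sharp$. The spectral signature is the pair (number of positive spectral coefficients, number of negative spectral coefficients), counted with multiplicity. *)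

(* Defs.v *)
From HB Require Import structures.
From mathcomp Require Import all_boot all_order all_algebra.
From mathcomp Require Import all_classical all_reals all_analysis.

Set Implicit Arguments.
Unset Strict Implicit.
Unset Printing Implicit Defensive.

Import Order.TTheory GRing.Theory Num.Theory.
Import numFieldNormedType.Exports.

Local Open Scope classical_set_scope.
Local Open Scope ring_scope.

(* Parities live in bool: false is even, true is odd, and the sum of parities
   is addb. The sign (-1)^{|a||b|} is written (-1) ^+ (i && j). *)

Record superalgebra (R : realType) := Superalgebra {
  sa_carrier :> vectType R;
  part : bool -> {vspace sa_carrier};
  jmul : {bilinear sa_carrier -> sa_carrier -> sa_carrier};
  part_sum : (part false + part true = fullv)%VS;
  part_direct : (part false :&: part true = 0)%VS;
  jmul_part : forall (i j : bool) (a b : sa_carrier),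
    a \in part i -> b \in part j -> jmul a b \in part (i (+) j)
}.

Section Superalgebra.
Variables (R : realType) (J : superalgebra R).
Implicit Types (a b c x u : J) (f g : 'End(J)) (i j : bool).

Definition Lmul a : 'End(J) := linfun (jmul J a).

Definition gl_part i f : Prop :=
  forall j, (f @: part J j <= part J (i (+) j)%B)%VS.

(* The bracket of gl(J) at homogeneous f, g of parities i, j. *)
Definition superbracket i j f g : 'End(J) :=
  (f \o g)%VF - (-1) ^+ (i && j) *: (g \o f)%VF.

Definition jordan_superalgebra : Prop :=
  (forall i j a b, a \in part J i -> b \in part J j ->
     jmul J a b = (-1) ^+ (i && j) *: jmul J b a) /\
  (forall (i j k : bool) a b c,
     a \in part J i -> b \in part J j -> c \in part J k ->
     superbracket i (j (+) k) (Lmul a) (Lmul (jmul J b c)) =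
       superbracket (i (+) j) k (Lmul (jmul J a b)) (Lmul c)
       - (-1) ^+ (i && j) *:
           superbracket j (i (+) k) (Lmul b) (Lmul (jmul J a c))).

Definition is_unit u : Prop := forall x, jmul J u x = x /\ jmul J x u = x.

Definition unital : Prop := exists u, is_unit u.

Definition pseudo_euclidean (beta : {biscalar J}) : Prop :=
  [/\ forall a b, a \in part J false -> b \in part J true ->
        beta a b = 0 /\ beta b a = 0,
      forall i j a b, a \in part J i -> b \in part J j ->
        beta a b = (-1) ^+ (i && j) * beta b a,
      forall a, (forall b, beta a b = 0) -> a = 0
    & forall a b c, beta (jmul J a b) c = beta a (jmul J b c)].

(* The trace of the restriction to U of an endomorphism preserving U, read off
   its matrix in the basis vbasis U of U. *)
Definition trace_on (U : {vspace J}) f : R :=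
  \sum_(k < \dim U) coord (vbasis U) k (f (vbasis U)`_k).

Definition tau a b : R := trace_on (part J false) (Lmul (jmul J a b)).

Definition positive_even_part : Prop :=
  (forall a b c,
     a \in part J false -> b \in part J false -> c \in part J false ->
     tau (jmul J a b) c = tau a (jmul J b c)) /\
  (forall a, a \in part J false -> a != 0 -> 0 < tau a a).

Definition lie_subsuperalgebra (U : {vspace 'End(J)}) : Prop :=
  (forall f, f \in U -> exists f0 f1,
     [/\ f0 \in U, f1 \in U, gl_part false f0, gl_part true f1
       & f = f0 + f1]) /\
  (forall i j f g, f \in U -> g \in U -> gl_part i f -> gl_part j g ->
     superbracket i j f g \in U).

Definition structure_algebra f : Prop :=
  forall U, lie_subsuperalgebra U -> (forall a, Lmul a \in U) -> f \in U.

Definition structure_algebra_even f : Prop :=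
  structure_algebra f /\ gl_part false f.

Definition expmx n (A : 'M[R]_n) : 'M[R]_n :=
  limn (series (fun k => (k`!%:R : R)^-1 *: A ^+ k)).

Definition exp_end f : 'End(J) :=
  let e := vbasis (fullv : {vspace J}) in
  passmx.hommx e e (expmx (passmx.mxof e e f)).

(* The connected Lie subgroup of GL(J) with Lie algebra g(J)_0 consists of the
   finite products of exponentials; these are closed under inversion, since
   exp(- f) is the inverse of exp f. *)
Inductive structure_group : 'End(J) -> Prop :=
| structure_group1 : structure_group \1%VF
| structure_groupM f g :
    structure_algebra_even f -> structure_group g ->
    structure_group (exp_end f \o g)%VF.

(* J_0^* is realised inside J^* as the even part of the dual super vector
   space, that is the functionals that vanish on J_1. *)
Definition even_dual (xi : 'Hom(J, R^o)) : Prop :=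
  forall x, x \in part J true -> xi x = 0.

Definition orbit0 (xi : 'Hom(J, R^o)) : set 'Hom(J, R^o) :=
  [set eta | exists2 g, structure_group g & eta = (xi \o g)%VF].

Definition flat (beta : {biscalar J}) : 'Hom(J, 'Hom(J, R^o)) :=
  linfun (fun x => linfun (beta x : J -> R^o)).

Definition sharp (beta : {biscalar J}) : 'Hom('Hom(J, R^o), J) :=
  (flat beta)^-1%VF.

Definition idempotent0 x : Prop := x \in part J false /\ jmul J x x = x.

Definition primitive x : Prop :=
  [/\ idempotent0 x, x != 0
    & ~ exists y z, [/\ idempotent0 y, idempotent0 z, y != 0, z != 0
                      & x = y + z]].

Definition jordan_frame r (e : 'I_r -> J) : Prop :=
  [/\ forall k, primitive (e k),
      forall k l, jmul J (e k) (e l) = if k == l then e k else 0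
    & is_unit (\sum_k e k)].

Definition spectral_decomposition x (s : seq R) : Prop :=
  exists2 e : 'I_(size s) -> J, jordan_frame e & x = \sum_(k < size s) s`_k *: e k.

(* When J_0 is positive and x is in J_0, a decomposition exists by the spectral
   theorem and s is unique up to permutation; xget picks one such s, and the
   signature below does not depend on the choice. *)
Definition spectral_coefficients x : seq R :=
  xget [::] [set s | spectral_decomposition x s].

Definition spectral_signature (beta : {biscalar J}) (xi : 'Hom(J, R^o)) :
    nat * nat :=
  let s := spectral_coefficients (sharp beta xi) in
  (count (fun l => 0 < l) s, count (fun l => l < 0) s).

End Superalgebra.

(* Main.v *)
(* The even part of the structure algebra consists of operators that act on J_0
   as L_a + D with D a derivation skew for the form, so under the form the orbit
   of a functional becomes a union of curves x' = a x + D x in the Euclidean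
   Jordan algebra J_0.  For Jordan frames e and f, the matrix
   M_ij = tau(e_i, f_j) / tau(e_i, e_i) is doubly stochastic, because
   non-orthogonal primitive idempotents have the same norm; it couples the spectra
   of nearby points, so N = sum_i H(lambda_i) is differentiable along the curve,
   with derivative sum_i H'(lambda_i) lambda_i tau(e_i, a) / tau(e_i, e_i).  If H
   is a smooth approximation of the indicator of the positive reals with
   |s H'(s)| <= 2 H(s), then Gronwall's inequality gives N(t) <= exp(K |t - s|) N(s)
   with K independent of H.  In the limit the number of positive eigenvalues
   satisfies the same inequality and, being an integer, is constant. *)
Require Import Defs.
From HB Require Import structures.
From mathcomp Require Import all_boot all_order all_algebra.
From mathcomp Require Import complex ring lra zify boolp.

Set Implicit Arguments.
Unset Strict Implicit.
Unset Printing Implicit Defensive.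

Import Order.TTheory GRing.Theory Num.Theory.
Local Open Scope ring_scope.

(** Eigenvalues of a moving point may collide, so no eigenvalue and no frame is followed along the
    curve: points are compared through arbitrarily chosen frames, and a second-order estimate of
    spectral sums takes the place of perturbation theory. Two forms are in play. [beta] may be
    indefinite on J_0 and only carries the dual action over to J, where skewness turns D into -D;
    all positivity comes from the trace form [tau]. The term D arises from brackets of
    multiplications, even or odd; to first order a derivation leaves the spectrum alone, whereas a
    moves each eigenvalue at a rate proportional to that eigenvalue. A smoothed count needs only to
    be within 1/2 of the true one, which suffices over short time steps; one step length serves the
    whole curve because all frames have the same size. *)

Lemma coord_ext (K : fieldType) (V : vectType K) (u v : V) :
  (forall i, coord (vbasis {:V}) i u = coord (vbasis {:V}) i v) -> u = v.
Proof.
move=> uv; rewrite (coord_vbasis (memvf u)) (coord_vbasis (memvf v)).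
by apply: eq_bigr => i _; rewrite uv.
Qed.

Section Coordinates.
Variables (K : fieldType) (V : vectType K).
Local Notation coord_ i := (coord (vbasis {:V}) i).

Lemma coord_vbasis0 i : coord_ i 0 = 0. Proof. exact: linear0. Qed.

Lemma coord_vbasisD i u v : coord_ i (u + v) = coord_ i u + coord_ i v.
Proof. exact: linearD. Qed.

Lemma coord_vbasisN i u : coord_ i (- u) = - coord_ i u.
Proof. exact: linearN. Qed.

Lemma coord_vbasisZ i t u : coord_ i (t *: u) = t * coord_ i u.
Proof. exact: linearZ. Qed.

End Coordinates.

Definition coordE := (coord_vbasis0, coord_vbasisD, coord_vbasisN, coord_vbasisZ).

(** * Euclidean Jordan algebras *)

Record euclidean_jordan (R : rcfType) := EuclideanJordan {
  ej_carrier :> vectType R;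
  ej_mul : {bilinear ej_carrier -> ej_carrier -> ej_carrier};
  ej_one : ej_carrier;
  ej_form : {biscalar ej_carrier};
  ej_mulC : forall a b, ej_mul a b = ej_mul b a;
  ej_mul1 : forall a, ej_mul ej_one a = a;
  (* [L_a, L_bc] = [L_ab, L_c] - [L_b, L_ac], applied to d. *)
  ej_jordan : forall a b c d,
    ej_mul a (ej_mul (ej_mul b c) d) - ej_mul (ej_mul b c) (ej_mul a d) =
    ej_mul (ej_mul a b) (ej_mul c d) - ej_mul c (ej_mul (ej_mul a b) d)
    - (ej_mul b (ej_mul (ej_mul a c) d) - ej_mul (ej_mul a c) (ej_mul b d));
  ej_formC : forall a b, ej_form a b = ej_form b a;
  ej_formA : forall a b c, ej_form (ej_mul a b) c = ej_form a (ej_mul b c);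
  ej_form_gt0 : forall a, a != 0 -> 0 < ej_form a a
}.

Section Algebra.
Variables (R : rcfType) (E : euclidean_jordan R).
Implicit Types (e f u v x y z : E) (p q r : {poly R}).

Local Notation "x ** y" := (ej_mul E x y) (at level 40, left associativity).
Local Notation one := (ej_one E).
Local Notation T := (ej_form E).

Let mulC := @ej_mulC R E.
Let mul1 := @ej_mul1 R E.
Let mulx1 x : x ** one = x. Proof. by rewrite mulC mul1. Qed.
Let formZl (t : R) x y : T (t *: x) y = t * T x y. Proof. exact: linearZl_LR. Qed.
Let formZr (t : R) x y : T x (t *: y) = t * T x y. Proof. exact: linearZr_LR. Qed.
Let formBl x y z : T (x - y) z = T x z - T y z. Proof. exact: linearBl. Qed.
Let formBr x y z : T x (y - z) = T x y - T x z. Proof. exact: linearBr. Qed.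

Ltac vec_lin := apply: coord_ext => ?; rewrite !coordE; lra.

(** * The polarised Jordan identity and the Peirce rules *)

Lemma jordan_sym a b c d :
  a ** ((b ** c) ** d) + b ** ((a ** c) ** d) + c ** ((a ** b) ** d) =
  (b ** c) ** (a ** d) + (a ** b) ** (c ** d) + (a ** c) ** (b ** d).
Proof.
have := ej_jordan a b c d => H.
apply: coord_ext => i; have := congr1 (coord (vbasis fullv) i) H.
rewrite !coordE; lra.
Qed.

(** The right side of [jordan_sym] is unchanged when [a] and [d] are exchanged. The exchanged form
    isolates multiplication by a triple product and writes it through multiplications by shorter
    ones. *)
Lemma mul_mul_mul a b c d :
  (a ** (b ** c)) ** d =
  (b ** c) ** (a ** d) + (a ** b) ** (c ** d) + (a ** c) ** (b ** d)
  - b ** (a ** (c ** d)) - c ** (a ** (b ** d)).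
Proof.
have H1 := jordan_sym d b c a; have H2 := jordan_sym a b c d.
rewrite !(mulC _ a) in H1.
rewrite [d ** c]mulC [d ** b]mulC [d ** (a ** _)]mulC in H1.
apply: coord_ext => i; have := congr1 (coord (vbasis fullv) i) H1.
have := congr1 (coord (vbasis fullv) i) H2.
rewrite !coordE.
rewrite [(a ** b) ** (c ** d)]mulC [(a ** c) ** (b ** d)]mulC.
rewrite [(b ** c) ** (a ** d)]mulC.
lra.
Qed.

Lemma form_sym_mul x y z : T (x ** y) z = T y (x ** z).
Proof. by rewrite mulC ej_formA. Qed.

Lemma form_ge0 x : 0 <= T x x.
Proof.
by have [->|/ej_form_gt0/ltW//] := eqVneq x 0; rewrite linear0l.
Qed.

Lemma form_eq0 x : T x x = 0 -> x = 0.
Proof.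
by move=> Tx0; apply/eqP/negPn/negP => /ej_form_gt0; rewrite Tx0 ltxx.
Qed.

(** At [e, e, y, z] the identity [jordan_sym] reads (2a - 1) e(yz) = (2a - 1) b yz; only the Peirce
    eigenvalue 1/2 escapes. *)
Lemma peirce_mul e (a b : R) y z : e ** e = e -> e ** y = a *: y ->
  e ** z = b *: z -> a *+ 2 != 1 ->
  e ** (y ** z) = b *: (y ** z).
Proof.
move=> ee ey ez a2.
have := jordan_sym e e y z.
rewrite ee ey ez !linearZl_LR !linearZr_LR /= => H.
have H2 : (a *+ 2 - 1) *: (e ** (y ** z)) = (a *+ 2 - 1) *: (b *: (y ** z)).
  apply: coord_ext => i; have := congr1 (coord (vbasis fullv) i) H.
  rewrite !coordE => H3; nra.
by move/scalerI: H2; apply; rewrite subr_eq0.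
Qed.

Lemma peirce_half_mul e y z : e ** e = e ->
  e ** y = 2%:R^-1 *: y -> e ** z = 2%:R^-1 *: z ->
  e ** (e ** (y ** z)) = e ** (y ** z).
Proof.
move=> ee ey ez; have ye : y ** e = 2%:R^-1 *: y by rewrite mulC.
have ze : z ** e = 2%:R^-1 *: z by rewrite mulC.
have := jordan_sym e y z e.
rewrite ee ey ez ye ze !linearZl_LR !linearZr_LR /= ye ze.
rewrite !linearZr_LR /= (mulC z y) !(mulC _ e) => H.
apply: coord_ext => i; have := congr1 (coord (vbasis fullv) i) H.
rewrite !coordE; lra.
Qed.

(** Multiplication by [e] is annihilated by t(t - 1)(2t - 1). Polynomials in it can thus serve as
    Peirce projections, with no decomposition of the space to construct. *)
Lemma peirce_cubic e y : e ** e = e ->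
  e ** y = 3%:R *: (e ** (e ** y)) - 2%:R *: (e ** (e ** (e ** y))).
Proof.
move=> ee; have := mul_mul_mul e e e y; rewrite !ee => {1}->; vec_lin.
Qed.

(** * Power associativity and polynomial calculus *)

Fixpoint jpow x n := if n is k.+1 then x ** jpow x k else one.

Lemma jordan_sqr x y : x ** ((x ** x) ** y) = (x ** x) ** (x ** y).
Proof.
have := ej_jordan x x x y => H.
apply: coord_ext => i; have := congr1 (coord (vbasis fullv) i) H.
rewrite !coordE; lra.
Qed.

(** By [mul_mul_mul], multiplication by x^(n+2) is expressed through those by x, x^2, x^n and
    x^(n+1). Hence the induction carries commutation with both x and x^2, at two consecutive
    exponents. *)
Lemma jpow_comm_sqr x n y :
  x ** (jpow x n ** y) = jpow x n ** (x ** y) /\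
  (x ** x) ** (jpow x n ** y) = jpow x n ** ((x ** x) ** y).
Proof.
suff : forall y, (x ** (jpow x n ** y) = jpow x n ** (x ** y) /\
  (x ** x) ** (jpow x n ** y) = jpow x n ** ((x ** x) ** y)) /\
  (x ** (jpow x n.+1 ** y) = jpow x n.+1 ** (x ** y) /\
  (x ** x) ** (jpow x n.+1 ** y) = jpow x n.+1 ** ((x ** x) ** y)).
  by move=> /(_ y)[].
elim: n {y} => [|n IH] y; first by rewrite /= mulx1 !mul1 jordan_sqr.
split; first by case: (IH y).
have c1 z := (IH z).1.1; have c2 z := (IH z).1.2.
have d1 z := (IH z).2.1; have d2 z := (IH z).2.2.
have e1 z : jpow x n.+2 ** z = jpow x n.+1 ** (x ** z) + (x ** x) ** (jpow x n ** z)
  + jpow x n.+1 ** (x ** z) - x ** (x ** (jpow x n ** z)) - jpow x n ** (x ** (x ** z)).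
  rewrite /= mul_mul_mul; vec_lin.
have sq := jordan_sqr x; rewrite !e1 !linearBr !linearDr /=.
by split; rewrite !(c1, d1, c2, d2, sq).
Qed.

Lemma jpow_comm x n y : x ** (jpow x n ** y) = jpow x n ** (x ** y).
Proof. exact: (jpow_comm_sqr x n y).1. Qed.

Definition jeval x (p : {poly R}) : E := \sum_(i < size p) p`_i *: jpow x i.

Lemma jeval_wide x p n : (size p <= n)%N ->
  jeval x p = \sum_(i < n) p`_i *: jpow x i.
Proof.
move=> pn; rewrite /jeval (big_ord_widen _ (fun i => p`_i *: jpow x i) pn).
rewrite big_mkcond /=; apply: eq_bigr => i _; case: ltnP => // /leq_sizeP -> //.
by rewrite scale0r.
Qed.

Lemma jeval_is_linear x : linear (jeval x).
Proof.
move=> a p q; set n := maxn (size p) (size q).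
have pn : (size p <= n)%N by rewrite leq_maxl.
have qn : (size q <= n)%N by rewrite leq_maxr.
rewrite (jeval_wide _ pn) (jeval_wide _ qn) (@jeval_wide _ _ n).
  rewrite scaler_sumr -big_split; apply: eq_bigr => i _ /=.
  by rewrite coefD coefZ scalerDl scalerA.
rewrite (leq_trans (size_polyD _ _)) // geq_max qn andbT.
by rewrite (leq_trans (size_scale_leq _ _)).
Qed.

HB.instance Definition _ x := GRing.isLinear.Build R {poly R} E _ (jeval x) (jeval_is_linear x).

Lemma jevalC x (c : R) : jeval x c%:P = c *: one.
Proof. by rewrite (@jeval_wide _ _ 1) ?size_polyC_leq1 // big_ord1 coefC. Qed.

Lemma jeval1 x : jeval x 1 = one.
Proof. by rewrite -polyC1 jevalC scale1r. Qed.

Lemma jevalMX x p : jeval x (p * 'X) = x ** jeval x p.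
Proof.
rewrite (@jeval_wide _ _ (size p).+1); last first.
  by have [->|p0] := eqVneq p 0; rewrite ?mul0r ?size_poly0 // size_mulX.
rewrite big_ord_recl coefMX /= scale0r add0r /jeval linear_sumr /=.
by apply: eq_bigr => i _; rewrite coefMX linearZr_LR.
Qed.

Lemma jeval_comm x p y : x ** (jeval x p ** y) = jeval x p ** (x ** y).
Proof.
rewrite /jeval !linear_sumlz linear_sumr; apply: eq_bigr => i _.
by rewrite !linearZl_LR linearZr_LR /= jpow_comm.
Qed.

Lemma jevalM x p q : jeval x (p * q) = jeval x p ** jeval x q.
Proof.
elim/poly_ind: p => [|p c IH]; first by rewrite mul0r linear0 linear0l.
rewrite mulrDl mulrAC linearD /= jevalMX IH linearD /= linearDl jevalMX jevalC.
by rewrite mul_polyC linearZ linearZl_LR /= mul1 !(mulC _ (jeval x q)) jeval_comm.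
Qed.

Lemma jeval_form x p q r : T (jeval x (p * q)) (jeval x r) = T (jeval x q) (jeval x (p * r)).
Proof. by rewrite !jevalM form_sym_mul. Qed.

(** * Annihilating polynomials and the spectral resolution *)

Lemma jeval_annihilator x : exists2 p, p != 0 & jeval x p = 0.
Proof.
set n := \dim {:E}.
pose M := \matrix_(i < n.+1, j < n) coord (vbasis {:E}) j (jpow x i).
have : kermx M != 0.
  by rewrite kermx_eq0 -row_leq_rank -ltnNge ltnS rank_leq_col.
case/rowV0Pn => v /sub_kermxP vM v0.
pose p := \poly_(i < n.+1) v 0 (inord i).
have pE (i : 'I_n.+1) : p`_i = v 0 i by rewrite coef_poly ltn_ord inord_val.
exists p.
  apply: contraNneq v0 => p0; apply/eqP/rowP => i.
  by rewrite -pE p0 coef0 mxE.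
rewrite (jeval_wide _ (size_poly _ _)); apply: coord_ext => j.
rewrite linear_sum linear0 /=.
transitivity ((v *m M) 0 j); last by rewrite vM mxE.
by rewrite mxE; apply: eq_bigr => i _; rewrite linearZ /= -/p pE mxE.
Qed.

(* Positivity of the form forces the minimal polynomial of [x] to have only
   real and simple roots. *)
Lemma jeval_quadratic_factor x (a b : R) p : b != 0 ->
  jeval x ((('X - a%:P) ^+ 2 + (b ^+ 2)%:P) * p) = 0 -> jeval x p = 0.
Proof.
move=> b0 H; apply: form_eq0.
have : T (jeval x ((('X - a%:P) ^+ 2 + (b ^+ 2)%:P) * p)) (jeval x p) = 0.
  by rewrite H linear0l.
rewrite mulrDl expr2 -mulrA mul_polyC linearD linearZ /= linearDl linearZl_LR /=.
rewrite jeval_form => H2.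
have := form_ge0 (jeval x (('X - a%:P) * p)); have := form_ge0 (jeval x p).
have : 0 < b ^+ 2 by rewrite exprn_even_gt0.
by move=> *; nra.
Qed.

Lemma jeval_double_root x (a : R) p :
  jeval x (('X - a%:P) * (('X - a%:P) * p)) = 0 -> jeval x (('X - a%:P) * p) = 0.
Proof.
move=> H; apply: form_eq0.
by rewrite jeval_form (mulrC _ (_ * p)) mulrC H linear0r.
Qed.

(** For a root a + ib in R[i] with b nonzero, the remainder of [p] modulo (X - a)^2 + b^2 has degree
    at most 1 and vanishes at a non-real point, hence is zero. *)
Lemma real_poly_factor p : size p != 1 ->
  (exists a q, p = ('X - a%:P) * q) \/
  (exists a b q, b != 0 /\ p = (('X - a%:P) ^+ 2 + (b ^+ 2)%:P) * q).
Proof.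
move=> p1; have : size (map_poly (real_complex R) p) != 1 by rewrite size_map_poly.
case/closed_rootP => -[a b] rz.
have [b0|b0] := eqVneq b 0.
  left; exists a; move: rz; rewrite b0 -[Complex a 0]/(real_complex R a) fmorph_root.
  by case/factor_theorem => q ->; exists q; rewrite mulrC.
right; exists a, b; set Q := _ + _; exists (p %/ Q); split => //.
have Qmon : size Q = 3.
  rewrite size_polyDl size_exp_XsubC // size_polyC; by case: (_ != _).
have rQ : (size (p %% Q)%R <= 2)%N.
  by have := ltn_modp p Q; rewrite -size_poly_eq0 Qmon.
have pE := divp_eq p Q; rewrite {1}pE; set r := p %% Q in pE rQ *.
suff -> : r = 0 by rewrite addr0 mulrC.
have Qz : (map_poly (real_complex R) Q).[Complex a b] = 0.
  rewrite /Q rmorphD rmorphXn rmorphB /= map_polyX !map_polyC /= !hornerE.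
  rewrite expr2; apply/eqP; rewrite eq_complex /=; apply/andP; split; apply/eqP; ring.
have : (map_poly (real_complex R) r).[Complex a b] = 0.
  move: rz; rewrite pE rmorphD rmorphM /= rootE hornerD hornerM Qz mulr0 add0r.
  by move/eqP.
rewrite (@horner_coef_wide _ 2) ?size_map_poly // big_ord_recl big_ord1 !coef_map /=.
rewrite expr0 expr1 mulr1 => /eqP; rewrite eq_complex /= => /andP[/eqP H1 /eqP H2].
have r1 : r`_1 = 0 by apply: (mulIf b0); rewrite mul0r; lra.
have r0 : r`_0 = 0 by move: H1; rewrite r1; lra.
apply/polyP => -[|[|k]]; rewrite coef0 //.
by rewrite nth_default // (leq_trans rQ).
Qed.

(** Factors leave the annihilator [p] one by one: a new real root moves into [s], while a repeated
    root or a quadratic factor is dropped by positivity. *)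
Lemma jeval_simple_roots x : exists2 s : seq R, uniq s &
  jeval x (\prod_(a <- s) ('X - a%:P)) = 0.
Proof.
have [p p0 px] := jeval_annihilator x.
have : exists2 s : seq R, uniq s & jeval x (p * \prod_(a <- s) ('X - a%:P)) = 0.
  by exists [::]; rewrite // big_nil mulr1.
move: {px} p0; have [n] := ubnP (size p); elim: n p => // n IH p pn p0 [s us Hs].
have [p1|p1] := eqVneq (size p) 1.
  have [c c0 pc] := size_poly1P _ (introT eqP p1).
  exists s => //; move: Hs; rewrite pc mul_polyC linearZ /= => /eqP.
  by rewrite scaler_eq0 (negPf c0) /= => /eqP.
have [[a [q pE]]|[a [b [q [b0 pE]]]]] := real_poly_factor p1.
  have q0 : q != 0 by apply: contraNneq p0 => q0; rewrite pE q0 mulr0.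
  apply: (IH q) => //.
    by move: pn; rewrite pE mulrC size_mul // ?polyXsubC_eq0 // size_XsubC addn2.
  have [as_|as_] := boolP (a \in s); last first.
    exists (a :: s); first by rewrite /= as_.
    by rewrite big_cons mulrCA mulrA -pE.
  exists s => //; move: Hs; rewrite pE (bigD1_seq a) //= => Hs.
  rewrite mulrCA; apply: jeval_double_root.
  by move: Hs; rewrite -mulrA [q * _]mulrCA.
have q0 : q != 0 by apply: contraNneq p0 => q0; rewrite pE q0 mulr0.
apply: (IH q) => //.
  move: pn; rewrite pE mulrC size_mul //.
    rewrite size_polyDl size_exp_XsubC // ?size_polyC; last by case: (_ != _).
    by rewrite addn3 /= => /ltnW.
  rewrite -size_poly_eq0 size_polyDl size_exp_XsubC // ?size_polyC.
  by case: (_ != _).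
exists s => //; move: Hs; rewrite pE -mulrA; exact: jeval_quadratic_factor.
Qed.

Lemma spectral_resolution x : exists (s : seq R) (c : R -> E),
  [/\ uniq s, forall a, exists p, c a = jeval x p,
      forall a, a \in s -> x ** c a = a *: c a & \sum_(a <- s) c a = one].
Proof.
have [s us Hs] := jeval_simple_roots x.
(* Lagrange polynomials: (X - a) L_a is a multiple of the annihilating product, and the sum of the
   L_a minus 1 has too many roots for its degree. *)
pose L a := (\prod_(b <- s | b != a) (a - b))^-1 *: \prod_(b <- s | b != a) ('X - b%:P).
exists s, (fun a => jeval x (L a)); split => // [a|a as_|]; first by exists (L a).
  rewrite -jevalMX; have -> : L a * 'X = a *: L a +
     (\prod_(b <- s | b != a) (a - b))^-1 *: \prod_(b <- s) ('X - b%:P).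
    rewrite [\prod_(b <- s) _](bigD1_seq a) //= /L -scalerAl mulrBl -!mul_polyC.
    ring.
  rewrite linearD; rewrite [X in _ + X = _]linearZ /= Hs scaler0 addr0.
  exact: linearZ.
(* With no roots the annihilator is 1, so the unit is zero and equals the empty sum. *)
case: s us Hs @L => [_ H0 L|a0 s us Hs L].
  by rewrite big_nil; move: H0; rewrite big_nil jeval1.
rewrite -linear_sum -(jeval1 x) /=; congr jeval; apply/eqP; rewrite -subr_eq0; apply/eqP.
have sz a : a \in a0 :: s -> (size (L a) <= (size s).+1)%N.
  move=> ain; rewrite (leq_trans (size_scale_leq _ _)) //.
  rewrite -big_filter size_prod_XsubC ltnS -rem_filter //.
  by rewrite size_rem.
apply: (@roots_geq_poly_eq0 _ _ (a0 :: s)) => //; last first.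
  rewrite (leq_trans (size_polyD _ _)) // geq_max size_polyN size_poly1 andbT /=.
  rewrite (leq_trans (size_sum _ _ _)) //; apply/bigmax_leqP_seq => a ain _; exact: sz.
apply/allP => b bin; rewrite rootE hornerD hornerN hornerC horner_sum.
rewrite (bigD1_seq b) //= big1_seq ?addr0; last first.
  move=> a /andP[ab ain]; rewrite hornerZ horner_prod; apply/eqP.
  rewrite mulf_eq0 prodf_seq_eq0; apply/orP; right; apply/hasP; exists b => //.
  by rewrite hornerXsubC subrr eqxx andbT eq_sym.
rewrite hornerZ horner_prod; under [X in _^-1 * X]eq_bigr do rewrite hornerXsubC.
rewrite mulVf ?subrr // prodf_seq_neq0; apply/allP => a ain; apply/implyP.
by rewrite subr_eq0 eq_sym.
Qed.

Let two_neq1 : (1 *+ 2 : R) != 1. Proof. by rewrite pnatr_eq1. Qed.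

(** * Idempotents, frames and the spectral theorem *)

Definition idem e := e ** e = e.

Definition eprimitive e := [/\ idem e, e != 0
  & ~ exists y z, [/\ idem y, idem z, y != 0, z != 0 & e = y + z]].

Definition eframe n (e : 'I_n -> E) := [/\ forall k, eprimitive (e k),
  forall k l, e k ** e l = if k == l then e k else 0 & \sum_k e k = one].

Lemma idem_add_orth y z : idem y -> idem z -> idem (y + z) -> y ** z = 0.
Proof.
rewrite /idem linearDl !linearDr /= (mulC z y) => yy zz; rewrite yy zz => H.
apply: coord_ext => i; have := congr1 (coord (vbasis fullv) i) H.
rewrite !coordE; lra.
Qed.

Lemma peirce1_mul e y z : idem e -> e ** y = y -> e ** z = z -> e ** (y ** z) = y ** z.
Proof.
move=> ee ey ez; have := @peirce_mul e 1 1 y z ee; rewrite !scale1r; apply => //.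
Qed.

Lemma peirce10_mul e y z : idem e -> e ** y = y -> e ** z = 0 -> y ** z = 0.
Proof.
move=> ee ey ez.
have := @peirce_mul e 1 0 y z ee; rewrite !scale1r !scale0r.
have := @peirce_mul e 0 1 z y ee; rewrite !scale1r !scale0r (mulC z).
move=> H1 H2; rewrite -H1 ?H2 // ?mul0rn ?two_neq1 1?eq_sym ?oner_eq0 //.
Qed.

Definition peirce1 e : {vspace E} := lker (linfun (ej_mul E e) - \1)%VF.

Lemma mem_peirce1 e y : (y \in peirce1 e) = (e ** y == y).
Proof. by rewrite memv_ker add_lfunE opp_lfunE id_lfunE lfunE /= subr_eq0. Qed.

(** The dimension of the eigenspace at 1 is the measure on which the splitting of idempotents
    terminates. *)
Lemma peirce1_proper y z : idem y -> idem z -> z != 0 -> y ** z = 0 ->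
  (\dim (peirce1 y) < \dim (peirce1 (y + z)))%N.
Proof.
move=> yy zz z0 yz.
have sub : (peirce1 y <= peirce1 (y + z))%VS.
  apply/subvP => v; rewrite !mem_peirce1 => /eqP yv.
  by rewrite linearDl /= yv [z ** v]mulC (peirce10_mul yy yv yz) addr0.
have [le eq] := dimv_leqif_sup sub; rewrite ltn_neqAle le eq andbT.
apply: contra z0 => /subvP /(_ (y + z)); rewrite !mem_peirce1.
rewrite linearDl !linearDr /= (mulC z y) yz yy zz addr0 add0r eqxx => /(_ isT).
by rewrite -subr_eq0 opprD addrA subrr sub0r oppr_eq0.
Qed.

(** The clause c e = e keeps the pieces of [c] in its Peirce 1-space; pieces of orthogonal
    idempotents are then orthogonal by [peirce10_mul]. *)
Lemma idem_split c : idem c -> exists es : seq E,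
  [/\ uniq es, forall e, e \in es -> eprimitive e /\ c ** e = e,
      forall e f, e \in es -> f \in es -> e != f -> e ** f = 0 & \sum_(e <- es) e = c].
Proof.
have [n] := ubnP (\dim (peirce1 c)); elim: n c => // n IH c cn cc.
have [->|c0] := eqVneq c 0; first by exists [::]; rewrite big_nil.
have [[y [z [yy zz y0 z0 cE]]]|cP] := pselect (exists y z,
    [/\ idem y, idem z, y != 0, z != 0 & c = y + z]); last first.
  exists [:: c]; split; rewrite ?big_seq1 //.
    by move=> e; rewrite inE => /eqP->.
  by move=> e f; rewrite !inE => /eqP-> /eqP->; rewrite eqxx.
have yz : y ** z = 0 by apply: idem_add_orth; rewrite -?cE.
have [es [ues esP eso esE]] : exists es : seq E,
  [/\ uniq es, forall e, e \in es -> eprimitive e /\ y ** e = e,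
      forall e f, e \in es -> f \in es -> e != f -> e ** f = 0 & \sum_(e <- es) e = y].
  by apply: IH => //; rewrite -ltnS (leq_trans _ cn) // ltnS cE peirce1_proper.
have [fs [ufs fsP fso fsE]] : exists es : seq E,
  [/\ uniq es, forall e, e \in es -> eprimitive e /\ z ** e = e,
      forall e f, e \in es -> f \in es -> e != f -> e ** f = 0 & \sum_(e <- es) e = z].
  by apply: IH => //; rewrite -ltnS (leq_trans _ cn) // ltnS cE addrC peirce1_proper // mulC.
have ef e f : e \in es -> f \in fs -> e ** f = 0.
  move=> /esP[_ ye] /fsP[_ zf]; apply: (peirce10_mul yy ye).
  by rewrite mulC; apply: (peirce10_mul zz zf); rewrite mulC.
exists (es ++ fs); split; last by rewrite big_cat /= esE fsE.
- rewrite cat_uniq ues ufs andbT; apply/hasPn => e efs; apply/negP => ees.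
  by have [[ee /negP e0 _] _] := esP _ ees; apply: e0; rewrite -ee (ef e e).
- move=> e; rewrite mem_cat cE linearDl.
  case/orP => [/[dup]/esP[pe ye]|/[dup]/fsP[pf zf]] /= ein; split=> //.
    rewrite ye [z ** e]mulC (peirce10_mul yy ye yz) addr0 //.
  by rewrite zf [y ** e]mulC (peirce10_mul zz zf) ?add0r // mulC.
- move=> e f; rewrite !mem_cat => /orP[] ein /orP[] fin.
  + exact: eso.
  + by move=> _; exact: ef.
  + by move=> _; rewrite mulC; exact: ef.
  + exact: fso.
Qed.

Definition spectral x (s : seq R) :=
  exists2 e : 'I_(size s) -> E, eframe e & x = \sum_(k < size s) s`_k *: e k.

(** Multiplication by [x] commutes with multiplication by a polynomial in [x], so x(c_a c_b) equals
    both a c_a c_b and b c_a c_b. *)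
Lemma resolution_orth x (s : seq R) (c : R -> E) :
  (forall a, exists p, c a = jeval x p) ->
  (forall a, a \in s -> x ** c a = a *: c a) ->
  forall a b, a \in s -> b \in s -> a != b -> c a ** c b = 0.
Proof.
move=> cP cx a b ain bin ab; have [p pE] := cP a.
have := jeval_comm x p (c b); rewrite -pE (cx b) // linearZr_LR /=.
rewrite [x ** _]mulC (mulC (c a)).
have [q qE] := cP b; rewrite {1 2}qE mulC jeval_comm -!qE cx // linearZr_LR /=.
move=> H; have /eqP : (a - b) *: (c b ** c a) = 0.
  by rewrite scalerBl H subrr.
by rewrite scaler_eq0 subr_eq0 (negPf ab) => /eqP.
Qed.

Lemma resolution_idem x (s : seq R) (c : R -> E) : uniq s ->
  (forall a, exists p, c a = jeval x p) ->
  (forall a, a \in s -> x ** c a = a *: c a) -> \sum_(a <- s) c a = one ->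
  forall a, a \in s -> idem (c a).
Proof.
move=> us cP cx c1 a ain; rewrite /idem -[RHS]mulx1 -c1 linear_sumr /=.
rewrite (bigD1_seq a) //= big1_seq ?addr0 // => b /andP[ba bin].
by apply: (resolution_orth cP cx) => //; rewrite eq_sym.
Qed.

Theorem spectral_exists x : exists s, spectral x s.
Proof.
have [s [c [us cP cx c1]]] := spectral_resolution x.
have cidem := resolution_idem us cP cx c1.
have corth := resolution_orth cP cx.
have /choice[F FP] : forall a : R, exists es : seq E, a \in s ->
  [/\ uniq es, forall e, e \in es -> eprimitive e /\ c a ** e = e,
      forall e f, e \in es -> f \in es -> e != f -> e ** f = 0 & \sum_(e <- es) e = c a].
  move=> a; have [ain|] := boolP (a \in s); last by exists [::].
  by have [es esP] := idem_split (cidem _ ain); exists es.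
(* Each idempotent is stored with its eigenvalue, so that multiplicities show up as repeated first
   components. *)
pose ps := [seq (a, e) | a <- s, e <- F a].
have ups : uniq ps.
  apply: allpairs_uniq_dep => // [a /FP[]//|].
  by move=> [a e] [b f] _ _ /= [-> ->].
have psP (p : R * E) : p \in ps -> p.1 \in s /\ p.2 \in F p.1.
  by case/allpairsPdep => a [e [ain ein ->]].
have porth (p q : R * E) : p \in ps -> q \in ps -> p != q -> p.2 ** q.2 = 0.
  case: p q => [a e] [b f] /psP[/= ain ein] /psP[/= bin fin] ne.
  have [_ Pa Oa _] := FP _ ain; have [_ Pb _ _] := FP _ bin.
  have [ab|ab] := eqVneq a b.
    by apply: Oa => //; [rewrite ab|apply: contraNneq ne => <-; rewrite ab].
  have [_ ce] := Pa _ ein; have [_ cf] := Pb _ fin.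
  apply: (peirce10_mul (cidem _ ain) ce).
  by rewrite mulC; apply: (peirce10_mul (cidem _ bin) cf); apply: corth => //; rewrite eq_sym.
have sz : size (map fst ps) = size ps by rewrite size_map.
exists (map fst ps), (fun k => (nth (0, 0) ps k).2).
  split=> [k|k l|].
  - have : nth (0, 0) ps k \in ps by rewrite mem_nth // -sz.
    by case/psP => /FP[_ P _ _] /P[].
  - have kp : (k < size ps)%N by rewrite -sz.
    have lp : (l < size ps)%N by rewrite -sz.
    case: eqP => [->|/eqP kl].
      by case/psP: (mem_nth (0, 0) lp) => /FP[_ P _ _] /P[[]].
    by apply: porth; rewrite ?mem_nth // nth_uniq.
  - rewrite -(big_mkord xpredT (fun k => (nth (0, 0) ps k).2)) sz.
    rewrite -(big_nth (0, 0) xpredT (fun p : R * E => p.2)) big_allpairs_dep /=.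
    rewrite -c1; apply: eq_big_seq => a /FP[_ _ _ <-] //.
rewrite -(big_mkord xpredT (fun k => (map fst ps)`_k *: (nth (0, 0) ps k).2)) sz.
rewrite (eq_big_nat _ _ (F2 := fun k => (nth (0, 0) ps k).1 *: (nth (0, 0) ps k).2)).
  rewrite -(big_nth (0, 0) xpredT (fun p : R * E => p.1 *: p.2)) big_allpairs_dep /=.
  rewrite -[x]mulx1 -c1 linear_sumr /=; apply: eq_big_seq => a ain.
  by rewrite -scaler_sumr cx //; have [_ _ _ ->] := FP _ ain.
by move=> k /= kp; rewrite (nth_map (0, 0)).
Qed.

(** T(ey, y) = T(y_1, y_1) + T(y_h, y_h) / 2, where y_1 = 2 e(ey) - ey and y_h = 4 (ey - e(ey)) are
    the Peirce components of [y] for 1 and 1/2. *)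
Lemma form_idem_ge0 e y : idem e -> 0 <= T (e ** y) y.
Proof.
move=> ee.
have c1 := congr1 (T y) (peirce_cubic y ee).
have c2 := congr1 (T y) (peirce_cubic (e ** y) ee).
have := form_ge0 (2%:R *: (e ** (e ** y)) - e ** y).
have := form_ge0 (4%:R *: (e ** y - e ** (e ** y))).
rewrite !(formBl, formZl, formBr, formZr).
rewrite !(formBr, formZr) in c1 c2.
rewrite !form_sym_mul.
lra.
Qed.

(** * Primitive idempotents and their norms *)

Lemma jeval_peirce1 e y p : idem e -> e ** y = y ->
  e ** (y ** jeval y p) = y ** jeval y p.
Proof.
move=> ee ey; elim/poly_ind: p => [|p c IH]; first by rewrite linear0 !linear0r.
rewrite linearD /= jevalMX jevalC !linearDr /= !linearZr_LR /= mulx1 ey.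
by rewrite (peirce1_mul ee).
Qed.

(** A spectral idempotent of [y] for a nonzero eigenvalue lies in the Peirce 1-space of [e] and
    splits off from [e]; primitivity leaves only [e] itself. *)
Lemma primitive_peirce1 e y : eprimitive e -> e ** y = y -> exists a : R, y = a *: e.
Proof.
move=> [ee e0 eP] ey; have [s [c [us cP cy c1]]] := spectral_resolution y.
have cidem := resolution_idem us cP cy c1.
have [[a [as_ a0 ca0]]|H] := pselect (exists a, [/\ a \in s, a != 0 & c a != 0]); last first.
  exists 0; rewrite scale0r -[y]mulx1 -c1 linear_sumr big1_seq //= => a ain.
  rewrite cy //; have [->|a0] := eqVneq a 0; first by rewrite scale0r.
  have [->|ca0] := eqVneq (c a) 0; first by rewrite scaler0.
  by case: H; exists a.
(* A polynomial in [y] may involve the unit, which need not lie in the Peirce 1-space; writing c_a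
   as y c_a / a with a nonzero removes that term. *)
have ec : e ** c a = c a.
  have [p pE] := cP a.
  rewrite -[c a](scalerK a0) -cy // linearZr_LR /= pE jeval_peirce1 //.
have [ce|ce] := eqVneq (e - c a) 0.
  by exists a; rewrite -{1}ey mulC (_ : e = c a) ?cy //; apply/eqP; rewrite -subr_eq0 ce.
case: eP; exists (c a), (e - c a); split => //; first exact: cidem.
  rewrite /idem linearBl !linearBr /= (mulC _ e) ee ec (cidem _ as_).
  by rewrite subrr subr0.
by rewrite addrC subrK.
Qed.

Lemma primitive_form_gt0 e : eprimitive e -> 0 < T e e.
Proof. by case=> _ /ej_form_gt0. Qed.

(** The polynomial 2 t^2 - t in multiplication by [e] projects onto the Peirce 1-space, a line for
    primitive [e]; pairing with [e] gives the coefficient. *)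
Lemma primitive_proj e y : eprimitive e ->
  2%:R *: (e ** (e ** y)) - e ** y = (T e y / T e e) *: e.
Proof.
move=> eP; have [ee e0 _] := eP; have Te := primitive_form_gt0 eP.
have [a aE] : exists a : R, 2%:R *: (e ** (e ** y)) - e ** y = a *: e.
  apply: primitive_peirce1 => //.
  have c1 := peirce_cubic y ee.
  apply: coord_ext => i; have := congr1 (coord (vbasis fullv) i) c1.
  rewrite linearBr linearZr_LR /= !coordE; lra.
rewrite aE; congr (_ *: _); apply: (mulIf (lt0r_neq0 Te)).
rewrite divfK ?lt0r_neq0 //.
have := congr1 (T e) aE; rewrite linearBr !linearZr_LR /= -!form_sym_mul !ee.
lra.
Qed.

(* The Peirce-1 component with respect to [e] of the Peirce-1 component of [e]
   with respect to [f] is [a^2 e] where [a e] is that of [f]; by symmetry of the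
   form this forces the two primitive idempotents to have the same norm. *)
Lemma primitive_form_eq e f : eprimitive e -> eprimitive f -> T e f != 0 ->
  T e e = T f f.
Proof.
move=> eP fP Tef; have [ee e0 _] := eP; have [ff f0 _] := fP.
have Te := primitive_form_gt0 eP; have Tf := primitive_form_gt0 fP.
have := primitive_proj f eP; set a := _ / _ => Pef.
have := primitive_proj e fP; rewrite ej_formC; set b := _ / _ => Pfe.
have cub := peirce_cubic f ee.
(* The Peirce components of [f] for 1/2 and 0, obtained from the polynomials 4(t - t^2) and (1 -
   t)(1 - 2t). *)
pose x := 4%:R *: (e ** f - e ** (e ** f)).
pose g := f - 3%:R *: (e ** f) + 2%:R *: (e ** (e ** f)).
have fE : f = a *: e + x + g by rewrite -Pef /x /g; vec_lin.
have ex : e ** x = 2%:R^-1 *: x.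
  rewrite /x linearZr_LR linearBr /=; apply: coord_ext => i.
  have := congr1 (coord (vbasis fullv) i) cub.
  rewrite !coordE; lra.
have eg : e ** g = 0.
  rewrite /g linearDr linearBr !linearZr_LR /=; apply: coord_ext => i.
  have := congr1 (coord (vbasis fullv) i) cub.
  rewrite !coordE; lra.
clearbody x g.
have exx := peirce_half_mul ee ex ex.
have egx : e ** (g ** x) = 2%:R^-1 *: (g ** x).
  apply: (@peirce_mul e 0) => //; first by rewrite scale0r.
  by rewrite mul0rn eq_sym oner_eq0.
have egg : e ** (g ** g) = 0.
  have := @peirce_mul e 0 0 g g ee; rewrite !scale0r; apply => //.
  by rewrite mul0rn eq_sym oner_eq0.
have ffE : f = a ^+ 2 *: e + a *: x + x ** x + 2%:R *: (g ** x) + g ** g.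
  rewrite -{1}ff fE !linearDl !linearDr /= !linearZl_LR !linearZr_LR /=.
  rewrite (mulC x e) (mulC g e) (mulC x g) ee ex eg; vec_lin.
have X : e ** (x ** x) = (a - a ^+ 2) *: e.
  have := Pef; rewrite {1 2}ffE !linearDr /= !linearZr_LR /= ee ex egx egg exx.
  rewrite ee !linearZr_LR /= linear0r ex egx => H.
  apply: coord_ext => i; have := congr1 (coord (vbasis fullv) i) H.
  rewrite !coordE; lra.
have fe : f ** e = a *: e + 2%:R^-1 *: x.
  by rewrite {1}fE mulC !linearDr /= linearZr_LR /= ee ex eg addr0.
have ffe : f ** (f ** e) = a ^+ 2 *: e + (3%:R / 4%:R * a) *: x
    + 2%:R^-1 *: (x ** x) + 2%:R^-1 *: (g ** x).
  rewrite fe linearDr /= !linearZr_LR /= fe {1}fE !linearDl /= linearZl_LR /= ex.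
  vec_lin.
have H : 2%:R *: (e ** (e ** (b *: f))) - e ** (b *: f) = a ^+ 2 *: e.
  rewrite -Pfe ffe fe !(linearDr, linearNr, linearZr_LR) /= !(ee, ex, egx, X).
  rewrite !(linearDr, linearNr, linearZr_LR) /= !(ee, ex, egx).
  vec_lin.
have : b * a = a ^+ 2.
  apply/eqP; rewrite -subr_eq0; move: H.
  rewrite !linearZr_LR /= scalerA [2 * b]mulrC -scalerA -scalerBr Pef scalerA => /eqP.
  by rewrite -subr_eq0 -scalerBl scaler_eq0 (negPf e0) orbF.
have a0 : a != 0 by rewrite mulf_neq0 // invr_eq0 lt0r_neq0.
rewrite expr2 => ba; have ab : b = a by exact: (mulIf a0).
by apply: invr_inj; apply: (mulfI Tef).
Qed.

Lemma primitive_form_ge0 e f : eprimitive e -> eprimitive f -> 0 <= T e f.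
Proof.
move=> [ee _ _] [ff _ _]; have := form_idem_ge0 e ff.
by rewrite ej_formA ee ej_formC.
Qed.

(** * The coupling between two frames *)

Section Coupling.
Variables (n m : nat) (e : 'I_n -> E) (f : 'I_m -> E).
Hypotheses (e_frame : eframe e) (f_frame : eframe f).

Lemma frame_form_sum (v : E) : eprimitive v -> \sum_j T v (f j) = T v v.
Proof.
have [_ _ f1] := f_frame; case=> vv _ _.
by rewrite -linear_sumr f1 -{1}vv ej_formA mulx1.
Qed.

Lemma frame_form_coef (la : 'I_n -> R) i :
  T (e i) (\sum_k la k *: e k) = la i * T (e i) (e i).
Proof.
have [eP eo _] := e_frame; rewrite linear_sumr (bigD1 i) //= big1 ?addr0 ?linearZr_LR //.
move=> k ki; have [ee _ _] := eP i; rewrite -{1}ee ej_formA linearZr_LR /= eo eq_sym (negPf ki).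
by rewrite scaler0 linear0r.
Qed.

End Coupling.

(** For symmetric matrices e = uu^T and f = vv^T with unit vectors u and v, this is the squared
    cosine of their angle; for primitive [e] it is the coefficient of the Peirce 1-component of [f]
    along [e]. *)
Definition coupling (e f : E) : R := T e f / T e e.

Lemma coupling_ge0 e f : eprimitive e -> eprimitive f -> 0 <= coupling e f.
Proof.
by move=> eP fP; rewrite divr_ge0 ?primitive_form_ge0 // ltW // primitive_form_gt0.
Qed.

Lemma couplingC e f : eprimitive e -> eprimitive f -> coupling e f = coupling f e.
Proof.
move=> eP fP; rewrite /coupling [T f e]ej_formC.
have [->|/(primitive_form_eq eP fP) ->//] := eqVneq (T e f) 0.
by rewrite !mul0r.
Qed.

Lemma coupling_sum n (f : 'I_n -> E) e : eframe f -> eprimitive e ->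
  \sum_j coupling e (f j) = 1.
Proof.
move=> fF eP; rewrite -mulr_suml (frame_form_sum fF eP) divff //.
by rewrite lt0r_neq0 ?primitive_form_gt0.
Qed.

Lemma eframe_size n m (e : 'I_n -> E) (f : 'I_m -> E) : eframe e -> eframe f -> n = m.
Proof.
move=> eF fF; have [[eP _ _] [fP _ _]] := (eF, fF).
apply/eqP; rewrite -(eqr_nat R); apply/eqP.
transitivity (\sum_(i < n) \sum_(j < m) coupling (e i) (f j)).
  rewrite (eq_bigr (fun=> 1)) => [|i _]; last exact: coupling_sum.
  by rewrite sumr_const card_ord.
rewrite exchange_big (eq_bigr (fun=> 1)) => [|j _]; first by rewrite sumr_const card_ord.
by rewrite -[RHS](coupling_sum eF (fP j)); apply: eq_bigr => i _; exact: couplingC.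
Qed.

Section Klein.
Variables (n m : nat) (e : 'I_n -> E) (f : 'I_m -> E).
Hypotheses (e_frame : eframe e) (f_frame : eframe f).
Variables (la : 'I_n -> R) (mu : 'I_m -> R).
Let x := \sum_i la i *: e i.
Let y := \sum_j mu j *: f j.

(** Row and column sums of T(e_i, f_j) give the norms of [x] and [y], the cross terms their pairing.
    Scalar quadratic remainders thus become distances. *)
Lemma frame_form_dist :
  \sum_i \sum_j T (e i) (f j) * (mu j - la i) ^+ 2 = T (y - x) (y - x).
Proof.
have [[eP _ _] [fP _ _]] := (e_frame, f_frame).
have xx : T x x = \sum_i \sum_j T (e i) (f j) * la i ^+ 2.
  rewrite {1}/x linear_sumlz; apply: eq_bigr => i _.
  rewrite linearZl_LR /= (frame_form_coef e_frame) -mulr_suml (frame_form_sum f_frame) //.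
  by ring.
have yy : T y y = \sum_i \sum_j T (e i) (f j) * mu j ^+ 2.
  rewrite exchange_big {1}/y linear_sumlz; apply: eq_bigr => j _.
  rewrite linearZl_LR /= (frame_form_coef f_frame) -mulr_suml.
  under eq_bigr do rewrite ej_formC.
  rewrite (frame_form_sum e_frame) //; ring.
have xy : T x y = \sum_i \sum_j T (e i) (f j) * (la i * mu j).
  rewrite /x linear_sumlz; apply: eq_bigr => i _.
  rewrite linearZl_LR linear_sumr mulr_sumr /=; apply: eq_bigr => j _.
  by rewrite linearZr_LR /=; ring.
rewrite linearBl !linearBr /= (ej_formC y x) xx yy xy -!sumrB.
apply: eq_bigr => i _; rewrite -!sumrB; apply: eq_bigr => j _; ring.
Qed.

(* [coupling] is doubly stochastic between two frames, so that a sum over either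
   spectrum is a double sum weighted by [coupling]. *)
Lemma klein_identity (H h : R -> R) :
  \sum_j H (mu j) - \sum_i H (la i) - \sum_i h (la i) * coupling (e i) (y - x) =
  \sum_i \sum_j coupling (e i) (f j) * (H (mu j) - H (la i) - h (la i) * (mu j - la i)).
Proof.
have [[eP _ _] [fP _ _]] := (e_frame, f_frame).
have -> : \sum_j H (mu j) = \sum_i \sum_j coupling (e i) (f j) * H (mu j).
  rewrite exchange_big; apply: eq_bigr => j _; rewrite -mulr_suml.
  by under eq_bigr do rewrite couplingC //; rewrite coupling_sum // mul1r.
rewrite -!sumrB; apply: eq_bigr => i _.
under [RHS]eq_bigr do rewrite mulrBr mulrBr.
rewrite !sumrB; congr (_ - _ - _); first by rewrite -mulr_suml coupling_sum // mul1r.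
under [RHS]eq_bigr do rewrite mulrCA mulrBr.
rewrite -mulr_sumr sumrB -[X in _ * (_ - X)]mulr_suml coupling_sum // mul1r.
congr (_ * _); rewrite /coupling linearBr /= mulrBl; congr (_ - _).
  rewrite linear_sumr mulr_suml; apply: eq_bigr => j _.
  by rewrite linearZr_LR /=; ring.
by rewrite (frame_form_coef e_frame) mulfK // lt0r_neq0 ?primitive_form_gt0.
Qed.

(** A second-order estimate for the scalar function [H] becomes one for its spectral sum. The sum of
    1 / T(e_i, e_i) pays for passing from the weights [coupling] to the weights of
    [frame_form_dist]. *)
Lemma klein_bound (H h : R -> R) (K : R) : 0 <= K ->
  (forall a b, `|H b - H a - h a * (b - a)| <= K * (b - a) ^+ 2) ->
  `|\sum_j H (mu j) - \sum_i H (la i) - \sum_i h (la i) * coupling (e i) (y - x)|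
    <= K * (\sum_i (T (e i) (e i))^-1) * T (y - x) (y - x).
Proof.
have [[eP _ _] [fP _ _]] := (e_frame, f_frame).
move=> K0 HK; rewrite klein_identity -frame_form_dist.
rewrite mulr_sumr (le_trans (ler_norm_sum _ _ _)) // ler_sum // => i _.
rewrite mulr_sumr (le_trans (ler_norm_sum _ _ _)) // ler_sum // => j _.
rewrite normrM ger0_norm ?coupling_ge0 //.
rewrite (le_trans (ler_wpM2l _ (HK _ _))) ?coupling_ge0 //.
have Te k := primitive_form_gt0 (eP k).
have Tef := primitive_form_ge0 (eP i) (fP j).
have : (T (e i) (e i))^-1 <= \sum_k (T (e k) (e k))^-1.
  rewrite (bigD1 i) //= lerDl sumr_ge0 // => k _; by rewrite invr_ge0 ltW.
rewrite /coupling => le; set C := \sum_k _ in le *.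
have := sqr_ge0 (mu j - la i); set q := _ ^+ 2 => q0.
have -> : T (e i) (f j) / T (e i) (e i) * (K * q) = K * T (e i) (f j) * q / T (e i) (e i) by ring.
have -> : K * C * (T (e i) (f j) * q) = K * T (e i) (f j) * q * C by ring.
apply: ler_wpM2l => //; apply: mulr_ge0 => //; exact: mulr_ge0.
Qed.

End Klein.

(** Differentiating e_j^2 = e_j gives T(e_j, D e_j) = 2 T(e_j, D e_j). Differentiating e_i e_j = 0
    gives e_i (D e_j) = - (D e_i) e_j, and the right side is orthogonal to e_i. *)
Lemma frame_form_derivation (D : {linear E -> E}) n (e : 'I_n -> E) i j :
  (forall y z, D (y ** z) = D y ** z + y ** D z) -> eframe e -> T (e i) (D (e j)) = 0.
Proof.
move=> DM [eP eo _]; have [ee _ _] := eP i.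
have [->|ij] := eqVneq i j.
  have [jj _ _] := eP j.
  have := congr1 (fun v => T (e j) (D v)) jj; rewrite DM linearDr /=.
  by rewrite [D (e j) ** _]mulC -!form_sym_mul jj; lra.
have := eo i j; rewrite (negPf ij) => ij0.
have := DM (e i) (e j); rewrite ij0 linear0 => /esym /eqP; rewrite addr_eq0 => /eqP Dij.
rewrite -{1}ee ej_formA -[_ ** D _]opprK -Dij linearNr /= [D _ ** _]mulC -form_sym_mul.
by rewrite mulC ij0 linear0l oppr0.
Qed.

(** The factor [la i] is the crux: an eigenvalue moves at a rate proportional to itself, which is
    what a bound on s H'(s) can exploit. *)
Lemma frame_form_flow (D : {linear E -> E}) a n (e : 'I_n -> E) (la : 'I_n -> R) i :
  (forall y z, D (y ** z) = D y ** z + y ** D z) -> eframe e ->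
  let x := \sum_k la k *: e k in
  T (e i) (a ** x + D x) = la i * T (e i) a.
Proof.
move=> DM eF x; rewrite linearDr /= [X in _ + X](_ : _ = 0) ?addr0; last first.
  rewrite /x linear_sum linear_sumr big1 // => k _ /=.
  by rewrite linearZ linearZr_LR /= (frame_form_derivation _ _ DM eF) mulr0.
have [eP eo _] := eF; rewrite mulC -form_sym_mul.
rewrite /x linear_sumlz (bigD1 i) //= big1 ?addr0.
  by rewrite linearZl_LR /= eo eqxx linearZl_LR.
by move=> k ki; rewrite linearZl_LR /= eo (negPf ki) scaler0.
Qed.

(** The bound is uniform over all primitive idempotents because the frame along the curve is
    uncontrolled. In a frame of [a], the couplings with [e] lie between 0 and 1. *)
Lemma coupling_bound a : exists2 K : R, 0 <= K &
  forall e, eprimitive e -> `|coupling e a| <= K.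
Proof.
have [s [f fF ->]] := spectral_exists a; have [fP _ _] := fF.
exists (\sum_(k < size s) `|s`_k|); first by rewrite sumr_ge0.
move=> e eP; have cE v w : coupling e (v + w) = coupling e v + coupling e w.
  by rewrite /coupling linearDr mulrDl.
rewrite {1}/coupling linear_sumr mulr_suml (le_trans (ler_norm_sum _ _ _)) // ler_sum // => k _.
rewrite linearZr_LR /= -mulrA normrM ler_piMr // ger0_norm ?coupling_ge0 //.
rewrite -(coupling_sum fF eP) (bigD1 k) //= /coupling lerDl sumr_ge0 // => j _.
exact: coupling_ge0.
Qed.

End Algebra.

From mathcomp Require Import all_classical all_reals all_analysis.
Import numFieldNormedType.Exports.
Local Open Scope classical_set_scope.
Local Open Scope ring_scope.

(** * Constancy of the signature along linear flows *)

Section RealFunctions.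
Variable R : realType.

(** The Caratheodory slope of N differs from that of A by at most that of B, which tends to 0. This
    serves for spectral sums, which come with no formula in the time. *)
Lemma is_derive_squeeze (N A B : R -> R) (t a : R) :
  is_derive t 1 A a -> is_derive t 1 B 0 ->
  (forall s, `|N s - N t - (A s - A t)| <= `|B s - B t|) -> is_derive t 1 N a.
Proof.
move=> /is_derive1_caratheodory [g [gE gc ga]] /is_derive1_caratheodory [b [bE bc b0]] H.
apply/is_derive1_caratheodory.
pose k z := if z == t then a else (N z - N t) / (z - t).
exists k; split => [z||]; last by rewrite /k eqxx.
  rewrite /k; case: eqP => [->|/eqP zt]; first by rewrite !subrr mulr0.
  by rewrite divfK // subr_eq0.
have kE : k = (fun z => g z + (k z - g z)) by apply/funext => z; rewrite addrC subrK.
have kg z : `|k z - g z| <= `|b z|.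
  rewrite /k; case: eqP => [->|/eqP zt]; first by rewrite ga subrr normr0.
  rewrite -(@ler_pM2r _ `|z - t|) ?normr_gt0 ?subr_eq0 // -!normrM mulrBl divfK ?subr_eq0 //.
  by rewrite -gE -bE.
suff : (fun z => g z + (k z - g z)) @ t --> g t + 0.
  have kt : k t = a by rewrite /k eqxx.
  by rewrite -kE addr0 ga -kt.
 apply: cvgD; first exact: gc.
apply/norm_cvg0P; apply: (@squeeze_cvgr _ _ _ _ (fun=> 0) (fun z => `|b z|)).
- by near=> z; rewrite normr_ge0 kg.
- exact: cvg_cst.
- by have /cvg_norm := bc; rewrite b0 normr0.
Unshelve. all: by end_near. Qed.

Lemma expR_decay (N N' : R -> R) (c : R) :
  (forall t : R, is_derive t 1 N (N' t)) -> (forall t, N' t + c * N t <= 0) ->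
  forall s t, s <= t -> N t * expR (c * t) <= N s * expR (c * s).
Proof.
move=> dN H s t st.
have dG (x : R) : is_derive x 1 (fun r => N r * expR (c * r))
    ((N' x + c * N x) * expR (c * x)).
  have dc : is_derive x 1 (fun r : R => c * r) c.
    have h := is_deriveZ c (is_derive_id x (1 : R)).
    by apply: (is_derive_eq h); rewrite /GRing.scale /= mulr1.
  have dE : is_derive x 1 (fun r => expR (c * r)) (expR (c * x) * c).
    exact: is_derive1_comp.
  have h := is_deriveM (dN x) dE; apply: (is_derive_eq h).
  by rewrite /GRing.scale /=; ring.
pose G (r : R) := N r * expR (c * r); rewrite -/(G t) -/(G s).
apply: (@ler0_derive1_le_cc _ G s t) => //.
- move=> x _; rewrite derive1E; have /@derive_val -> := dG x.
  by rewrite pmulr_lle0 ?expR_gt0.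
- apply: continuous_subspaceT => x; apply: differentiable_continuous.
  by apply/derivable1_diffP; exact: ex_derive.
- by rewrite in_itv /= st lexx.
- by rewrite in_itv /= st lexx.
Qed.

(** Both directions of time are covered: N e^(-Kt) does not increase and N e^(Kt) does not
    decrease. *)
Lemma gronwall (N N' : R -> R) (K : R) :
  (forall t : R, is_derive t 1 N (N' t)) -> (forall t, `|N' t| <= K * N t) ->
  forall s t, N t <= expR (K * `|t - s|) * N s.
Proof.
move=> dN bN s t; have [st|ts] := lerP s t.
  have := @expR_decay N N' (- K) dN _ s t st.
  move=> H.
  have {}H : N t * expR (- K * t) <= N s * expR (- K * s).
    apply: H => r; rewrite mulNr subr_le0.
    by apply: le_trans (bN r); exact: ler_norm.
  rewrite -(@ler_pM2r _ (expR (- K * t))) ?expR_gt0 // (le_trans H) //.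
  rewrite mulrAC -expRD mulrC le_eqVlt; apply/orP; left; apply/eqP.
  by congr (expR _ * _); ring.
have := @expR_decay (- N) (- N') K _ _ t s (ltW ts).
move=> H.
have {}H : - N s * expR (K * s) <= - N t * expR (K * t).
  apply: H => r.
  rewrite /= mulrN -opprD oppr_le0 -lerBlDr sub0r.
  by rewrite lerNl; apply: le_trans (bN r); rewrite -normrN ler_norm.
rewrite -(@ler_pM2r _ (expR (K * t))) ?expR_gt0 //.
rewrite !mulNr lerN2 in H; rewrite (le_trans H) //.
rewrite mulrAC -expRD mulrC le_eqVlt; apply/orP; left; apply/eqP.
by congr (expR _ * _); ring.
Qed.

End RealFunctions.

(** * A smoothed indicator of the positive reals *)

Section StepFunction.
Variable R : realFieldType.

(* [step d] tends to the indicator of the positive reals as [d] tends to 0, and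
   its derivative [dstep d] satisfies [|s dstep d s| <= 2 step d s] for every [d]. *)
Definition step (d s : R) := if 0 < s then s ^+ 2 / (s ^+ 2 + d) else 0.
Definition dstep (d s : R) := if 0 < s then 2 * d * s / (s ^+ 2 + d) ^+ 2 else 0.

Section Step.
Variables (d : R) (d0 : 0 < d).

Lemma step_den_gt0 (s : R) : 0 < s ^+ 2 + d.
Proof. by rewrite ltr_wpDl ?sqr_ge0. Qed.

Lemma step_ge0 (s : R) : 0 <= step d s.
Proof.
by rewrite /step; case: ifP => // _; rewrite divr_ge0 ?sqr_ge0 // ltW ?step_den_gt0.
Qed.

Lemma step_le1 (s : R) : step d s <= 1.
Proof.
rewrite /step; case: ifP => // _; rewrite ler_pdivrMr ?step_den_gt0 // mul1r.
by rewrite lerDl ltW.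
Qed.

Lemma step_ge (c s : R) : 0 < c -> c <= s -> 1 - d / c ^+ 2 <= step d s.
Proof.
move=> c0 cs; rewrite /step (lt_le_trans c0 cs).
have D := step_den_gt0 s; have c2 : 0 < c ^+ 2 by rewrite exprn_gt0.
rewrite ler_pdivlMr // -(@ler_pM2r _ (c ^+ 2)) // mulrAC mulrBl mulfVK ?lt0r_neq0 //.
have : c ^+ 2 <= s ^+ 2 by rewrite lerXn2r // nnegrE; lra.
have : 0 <= d * s ^+ 2 - d * c ^+ 2 + d ^+ 2.
  have : d * c ^+ 2 <= d * s ^+ 2 by rewrite ler_pM2l // lerXn2r // nnegrE; lra.
  have := sqr_ge0 d; lra.
by move=> *; nra.
Qed.

Lemma dstep_bound (s : R) : `|dstep d s * s| <= 2 * step d s.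
Proof.
rewrite /dstep /step; case: ifP => s0; last by rewrite mul0r mulr0 normr0.
have D := step_den_gt0 s.
rewrite ger0_norm; last first.
  by rewrite mulr_ge0 ?ltW // divr_gt0 ?exprn_gt0 // !mulr_gt0.
have -> : 2 * d * s / (s ^+ 2 + d) ^+ 2 * s =
    2 * (s ^+ 2 / (s ^+ 2 + d)) * (d / (s ^+ 2 + d)).
  by field; rewrite lt0r_neq0.
rewrite ler_piMr //.
  by rewrite mulr_ge0 // divr_ge0 ?sqr_ge0 // ltW.
by rewrite ler_pdivrMr // mul1r lerDr sqr_ge0.
Qed.

(** The second derivative jumps at 0, whence the four sign cases. The constant 2 / d grows as [d]
    shrinks, which is harmless: it yields only differentiability, never the rate in Gronwall's
    inequality. *)
Lemma step_taylor (a b : R) :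
  `|step d b - step d a - dstep d a * (b - a)| <= 2 / d * (b - a) ^+ 2.
Proof.
have dp : 0 < d := d0; rewrite /step /dstep; have Da := step_den_gt0 a; have Db := step_den_gt0 b.
case: ifP => b0; case: ifP => a0.
- have -> : b ^+ 2 / (b ^+ 2 + d) - a ^+ 2 / (a ^+ 2 + d) -
     2 * d * a / (a ^+ 2 + d) ^+ 2 * (b - a) =
     d * (d - a ^+ 2 - 2 * a * b) / ((a ^+ 2 + d) ^+ 2 * (b ^+ 2 + d)) * (b - a) ^+ 2.
    by field; rewrite !lt0r_neq0.
  rewrite normrM (ger0_norm (sqr_ge0 _)) ler_wpM2r ?sqr_ge0 //.
  have ab : 0 < a * b by rewrite mulr_gt0.
  have : `|d - a ^+ 2 - 2 * a * b| <= d + a ^+ 2 + 2 * a * b.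
    have := sqr_ge0 a; rewrite ler_norml => a2; apply/andP; split; nra.
  have P0 : 0 < (a ^+ 2 + d) ^+ 2 * (b ^+ 2 + d) by rewrite mulr_gt0 // exprn_gt0.
  rewrite !normrM normfV (gtr0_norm P0) (gtr0_norm d0) ler_pdivrMr // => Y.
  rewrite [X in _ <= X]mulrAC ler_pdivlMr //.
  apply: le_trans (ler_wpM2r (ltW d0) (ler_wpM2l (ltW d0) Y)) _.
  rewrite -subr_ge0.
  have -> : 2 * ((a ^+ 2 + d) ^+ 2 * (b ^+ 2 + d)) - d * (d + a ^+ 2 + 2 * a * b) * d =
    2 * (a ^+ 2 * a ^+ 2 * (b ^+ 2 + d) + a ^+ 2 * d * (2 * b ^+ 2 + d))
     + d ^+ 2 * ((a - b) ^+ 2 + b ^+ 2 + d) by ring.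
  by repeat first [apply: sqr_ge0 | exact: ler0n | exact: ltW | apply: addr_ge0 | apply: mulr_ge0].
- have ba : b ^+ 2 <= (b - a) ^+ 2.
    by rewrite lerXn2r // ?nnegrE; move/negbT: a0; rewrite -leNgt; lra.
  rewrite mul0r !subr0 ger0_norm; last by rewrite divr_ge0 ?sqr_ge0 // ltW.
  rewrite ler_pdivrMr // [X in _ <= X](_ : _ = 2 * (b - a) ^+ 2 * (b ^+ 2 + d) / d); last by ring.
  rewrite ler_pdivlMr //.
  have : 0 <= (b - a) ^+ 2 * b ^+ 2 by rewrite mulr_ge0 ?sqr_ge0.
  have : b ^+ 2 * d <= (b - a) ^+ 2 * d by rewrite ler_pM2r.
  by move=> *; nra.
- have {}b0 : b <= 0 by rewrite leNgt b0.
  have X0 : 0 <= a ^+ 2 / (a ^+ 2 + d) by rewrite divr_ge0 ?sqr_ge0 // ltW.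
  have X1 : a ^+ 2 / (a ^+ 2 + d) <= a ^+ 2 / d.
    by rewrite ler_wpM2l ?sqr_ge0 // lef_pV2 ?posrE // lerDr sqr_ge0.
  have Y0 : 0 <= 2 * d * a / (a ^+ 2 + d) ^+ 2.
    by rewrite divr_ge0 ?sqr_ge0 // !mulr_ge0 // ltW.
  have Y1 : 2 * d * a / (a ^+ 2 + d) ^+ 2 <= 2 / d * a.
    rewrite ler_pdivrMr ?exprn_gt0 // -subr_ge0.
    have -> : 2 / d * a * (a ^+ 2 + d) ^+ 2 - 2 * d * a =
      2 / d * a * (a ^+ 2 * (a ^+ 2 + 2 * d)) by field; rewrite lt0r_neq0.
    by rewrite !mulr_ge0 ?addr_ge0 ?sqr_ge0 ?invr_ge0 ?mulr_ge0 // ltW.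
  set X := a ^+ 2 / _ in X0 X1 *; set Y := _ / _ ^+ 2 in Y0 Y1 *; clearbody X Y.
  have d1 : 0 <= d^-1 by rewrite invr_ge0 ltW.
  have XX : X <= 2 / d * (b - a) ^+ 2.
    apply: le_trans X1 _; rewrite [X in _ <= X]mulrAC ler_wpM2r //.
    by rewrite -subr_ge0; nra.
  have YY : Y * (a - b) <= 2 / d * (b - a) ^+ 2.
    apply: le_trans (ler_wpM2r _ Y1) _; first lra.
    rewrite -[X in X <= _]mulrA ler_wpM2l ?mulr_ge0 //.
    by nra.
  have Y2 : 0 <= Y * (a - b) by rewrite mulr_ge0 //; lra.
  have -> : 0 - X - Y * (b - a) = Y * (a - b) - X by ring.
  by rewrite ler_norml; apply/andP; split; lra.
- by rewrite mul0r !subr0 normr0 mulr_ge0 ?sqr_ge0 // divr_ge0 // ltW.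
Qed.

End Step.
End StepFunction.

(** * Spectral sums along a curve *)

Section Flow.
Variables (R : realType) (E : euclidean_jordan R).
Local Notation "x ** y" := (ej_mul E x y) (at level 40, left associativity).
Local Notation T := (ej_form E).

Lemma count_sum (s : seq R) (P : pred R) :
  (count P s)%:R = \sum_(k < size s) (P s`_k)%:R :> R.
Proof.
rewrite -(big_mkord xpredT (fun k => (P s`_k)%:R)) -(big_nth 0 xpredT (fun l => (P l)%:R)).
elim: s => [|l s IH]; first by rewrite big_nil.
by rewrite big_cons /= natrD IH.
Qed.

Definition step_sum (d : R) (s : seq R) := \sum_(k < size s) step d s`_k.

Lemma step_sum_le d s : 0 < d -> step_sum d s <= (count (fun l => 0 < l) s)%:R.
Proof.
move=> d0; rewrite count_sum; apply: ler_sum => k _.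
by case: (ltP 0 s`_k) => h; [exact: step_le1|rewrite /step ltNge h].
Qed.

Lemma pos_lower_bound (s : seq R) : exists2 c : R, 0 < c & forall l, l \in s -> 0 < l -> c <= l.
Proof.
elim: s => [|l s [c c0 H]]; first by exists 1.
have [l0|l0] := ltP 0 l.
  exists (Num.min c l) => [|k]; first by rewrite lt_min c0.
  by rewrite inE ge_min => /orP[/eqP -> _|ks /(H _ ks) ->//]; rewrite lexx orbT.
exists c => // k; rewrite inE => /orP[/eqP -> l0'|]; last exact: H.
by have := lt_le_trans l0' l0; rewrite ltxx.
Qed.

Lemma step_sum_ge (s : seq R) : exists2 d : R, 0 < d &
  (count (fun l => 0 < l) s)%:R - 2^-1 <= step_sum d s.
Proof.
have [c c0 cP] := pos_lower_bound s.
have n0 : 0 < 2 * (size s).+1%:R :> R by rewrite mulr_gt0.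
have d0 : 0 < c ^+ 2 / (2 * (size s).+1%:R) by rewrite divr_gt0 // exprn_gt0.
(* With this value each positive entry misses 1 by at most 1 / (2 (size s + 1)), so all of them
   together by less than 1/2. *)
exists (c ^+ 2 / (2 * (size s).+1%:R)) => //; set d := _ / _ in d0 *.
have dc : d / c ^+ 2 = (2 * (size s).+1%:R)^-1.
  by rewrite /d mulrAC divff ?mul1r // expf_neq0 // lt0r_neq0.
rewrite lerBlDr count_sum.
have : \sum_(k < size s) (0 < s`_k)%R%:R <= step_sum d s + \sum_(k < size s) d / c ^+ 2.
  rewrite -big_split /=; apply: ler_sum => k _; case: ltP => sk /=.
    rewrite -lerBlDr; apply: step_ge => //; apply: cP => //; exact: mem_nth.
  by rewrite addr_ge0 ?step_ge0 // divr_ge0 ?sqr_ge0 // ltW.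
move=> /le_trans -> //; rewrite lerD2l sumr_const card_ord dc -[_ *+ size s]mulr_natr.
by rewrite invfM -mulrA ler_piMr ?invr_ge0 // mulrC ler_pdivrMr // mul1r ler_nat.
Qed.

Variables (D : {linear E -> E}) (a : E) (X : R -> E).
Hypothesis DM : forall y z, D (y ** z) = D y ** z + y ** D z.
(** The equation X' = a X + D X is tested on linear functionals, so no norm on the space has to be
    chosen. *)
Hypothesis dX : forall (l : {scalar E}) (t : R),
  is_derive t 1 (fun s => l (X s)) (l (a ** X t + D (X t))).

Lemma derive_form_sqr (t : R) : is_derive t 1 (fun s => T (X s - X t) (X s - X t)) 0.
Proof.
set b := vbasis {:E}.
have vE v : T v v = \sum_k coord b k v * T b`_k v.
  rewrite {1}(coord_vbasis (memvf v)) linear_sumlz; apply: eq_bigr => k _.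
  by rewrite linearZl_LR.
have dl (l : {scalar E}) : is_derive t 1 (fun s => l (X s - X t)) (l (a ** X t + D (X t))).
  have h := is_deriveB (dX l t) (is_derive_cst (l (X t)) t 1).
  have -> : (fun s => l (X s - X t)) = (fun s => l (X s)) - cst (l (X t)).
    by apply/funext => s; rewrite linearB.
  by apply: (is_derive_eq h); rewrite subr0.
pose F k s := coord b k (X s - X t) * T b`_k (X s - X t).
have -> : (fun s => T (X s - X t) (X s - X t)) = \sum_k F k.
  by apply/funext => s; rewrite vE fct_sumE.
have dF k : is_derive t 1 (F k) 0.
  have h := is_deriveM (dl (coord b k)) (dl (T b`_k)).
  by apply: (is_derive_eq h); rewrite subrr !linear0 !scale0r addr0.
by have h := is_derive_sum dF; apply: (is_derive_eq h); rewrite big1.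
Qed.

Definition chosen_spectrum x : seq R := projT1 (cid (spectral_exists (x : E))).

Lemma chosen_spectrumP x : spectral x (chosen_spectrum x).
Proof. by rewrite /chosen_spectrum; case: cid. Qed.

(** For two frames of one element the right side of [klein_bound] is zero, so an arbitrary choice of
    spectrum at each time does no harm. *)
Lemma step_sum_uniq d x s s' : 0 < d -> spectral (x : E) s -> spectral x s' ->
  step_sum d s = step_sum d s'.
Proof.
move=> d0 [e eF xE] [f fF xE'].
have K0 : 0 <= 2 / d by rewrite divr_ge0 // ltW.
have := klein_bound eF fF (fun k => s`_k) (fun k => s'`_k) K0 (step_taylor d0).
rewrite -xE -xE' subrr linear0r mulr0.
rewrite [X in _ - X]big1 ?subr0 => [|i _]; last by rewrite /coupling linear0r mul0r mulr0.
by rewrite normr_le0 subr_eq0 => /eqP.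
Qed.

(** [K] is fixed before [d]: its factor 2 comes from [dstep_bound], the rest from
    [coupling_bound]. *)
Lemma step_sum_flow : exists2 K : R, 0 <= K & forall (d s t : R) ss st, 0 < d ->
  spectral (X s) ss -> spectral (X t) st ->
  step_sum d st <= expR (K * `|t - s|) * step_sum d ss.
Proof.
have [K K0 KP] := coupling_bound a.
exists (2 * K); first by rewrite mulr_ge0.
move=> d s t ss st d0 sP tP.
pose N r := step_sum d (chosen_spectrum (X r)).
rewrite (step_sum_uniq d0 sP (chosen_spectrumP _)) (step_sum_uniq d0 tP (chosen_spectrumP _)).
have main (r : R) : exists2 c : R, is_derive r 1 N c & `|c| <= 2 * K * N r.
  have [e eF xE] := chosen_spectrumP (X r); have [eP _ _] := eF.
  set S := chosen_spectrum (X r) in e eF eP xE.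
  (* The gradient at [X r] of the spectral sum of [step d], with respect to the form. *)
  pose u : E := \sum_(k < size S) (dstep d S`_k / T (e k) (e k)) *: e k.
  have uE v : T u v = \sum_(k < size S) dstep d S`_k * coupling (e k) v.
    rewrite linear_sumlz; apply: eq_bigr => k _; rewrite linearZl_LR /= /coupling.
    by rewrite mulrAC mulrA.
  exists (T u (a ** X r + D (X r))).
    have K1 : 0 <= 2 / d by rewrite divr_ge0 // ltW.
    pose C := 2 / d * (\sum_k (T (e k) (e k))^-1).
    have dB : is_derive r 1 (fun s => C * T (X s - X r) (X s - X r)) 0.
      have h := is_deriveZ C (derive_form_sqr r).
      by apply: (is_derive_eq h); rewrite scaler0.
    apply: (is_derive_squeeze (dX (T u) r) dB) => q.
    rewrite subrr linear0r mulr0 subr0 -linearBr uE.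
    have [f fF yE] := chosen_spectrumP (X q).
    have := klein_bound eF fF (fun k => S`_k) (fun k => (chosen_spectrum (X q))`_k)
      K1 (step_taylor d0).
    rewrite -xE -yE => H; apply: le_trans H _; exact: ler_norm.
  rewrite uE /N /step_sum mulrAC mulr_sumr mulr_suml (le_trans (ler_norm_sum _ _ _)) //.
  apply: ler_sum => k _; rewrite -/S /coupling.
  have -> : T (e k) (a ** X r + D (X r)) = S`_k * T (e k) a.
    by rewrite xE (frame_form_flow _ _ _ DM eF).
  have -> : dstep d S`_k * (S`_k * T (e k) a / T (e k) (e k)) =
     dstep d S`_k * S`_k * (T (e k) a / T (e k) (e k)) by rewrite !mulrA.
  rewrite normrM ler_pM ?normr_ge0 //.
    exact: dstep_bound.
  exact: KP.
have /choice[N' N'P] : forall r : R, exists c : R, is_derive r 1 N c /\ `|c| <= 2 * K * N r.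
  by move=> r; have [c] := main r; exists c.
have dN (r : R) : is_derive r 1 N (N' r) by have [] := N'P r.
have bN (r : R) : `|N' r| <= 2 * K * N r by have [] := N'P r.
exact: (gronwall dN bN).
Qed.

Theorem flow_pos_count s0 s1 : spectral (X 0) s0 -> spectral (X 1) s1 ->
  count (fun l => 0 < l) s0 = count (fun l => 0 < l) s1.
Proof.
move=> S0 S1; have [K K0 KP] := step_sum_flow.
pose p s := count (fun l : R => 0 < l) s.
pose n := size s0.
have pn r s : spectral (X r) s -> (p s <= n)%N.
  case=> e eF _; have [f fF _] := S0.
  by rewrite (leq_trans (count_size _ _)) // (eframe_size eF fF).
(* Growth over time [h] adds less than 1/2 to a count of at most [n], and smoothing loses at most
   1/2, so an integer count cannot rise by 1. *)
have [h h0 hP] : exists2 h : R, 0 < h & expR (K * h) * n%:R < n%:R + 2^-1.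
  (* The successor [n.+1] and, below, [K + 1] keep the divisors positive when [n] or [K] is zero. *)
  pose q : R := 1 + (2 * n.+1%:R)^-1.
  have q1 : 1 < q by rewrite ltrDl invr_gt0 mulr_gt0.
  have K1 : 0 < K + 1 by rewrite ltr_wpDl.
  exists (ln q / (K + 1)); first by rewrite divr_gt0 // ln_gt0.
  have : expR (K * (ln q / (K + 1))) <= q.
    rewrite -[X in _ <= X]lnK ?posrE ?(lt_trans ltr01) // ler_expR mulrCA ler_piMr //.
      by rewrite ltW // ln_gt0.
    by rewrite ler_pdivrMr // mul1r lerDl.
  move=> /(ler_wpM2r (ler0n R n)) H; apply: le_lt_trans H _.
  rewrite mulrDl mul1r ltrD2l invfM -mulrA gtr_pMr ?invr_gt0 // mulrC ltr_pdivrMr // mul1r.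
  by rewrite ltr_nat.
have step_le (s t : R) ss st : `|t - s| <= h -> spectral (X s) ss -> spectral (X t) st ->
    (p st <= p ss)%N.
  move=> ts sP tP; have [d d0 dP] := step_sum_ge st.
  rewrite -ltnS -(ltr_nat R).
  have := KP d s t ss st d0 sP tP; have := step_sum_le ss d0.
  have e1 : 1 <= expR (K * `|t - s|) by rewrite -expR0 ler_expR mulr_ge0.
  have e2 : expR (K * `|t - s|) <= expR (K * h) by rewrite ler_expR ler_wpM2l.
  have e3 : (p ss)%:R <= n%:R :> R by rewrite ler_nat (pn s).
  rewrite -natr1 -/(p ss); rewrite -/(p st) in dP.
  set e := expR _ in e1 e2 *; set f := expR _ in e2 hP.
  move=> u1 u2.
  have u3 : e * step_sum d ss <= e * (p ss)%:R by rewrite ler_wpM2l // (le_trans ler01).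
  have : (e - 1) * (p ss)%:R <= (f - 1) * n%:R.
    by rewrite ler_pM ?subr_ge0 ?ler0n // lerD2r.
  rewrite !mulrBl !mul1r; move: hP dP => hP' dP'; lra.
have step_eq (s t : R) ss st : `|t - s| <= h -> spectral (X s) ss -> spectral (X t) st ->
    p st = p ss.
  move=> ts sP tP; apply/eqP; rewrite eqn_leq (step_le s t) //=.
  by rewrite (step_le t s) // distrC.
have [m mP] : exists m : nat, (m.+1%:R)^-1 <= h.
  exists (Num.truncn h^-1); rewrite invf_ple ?posrE //; last by rewrite ltW ?truncnS_gt.
have ind k s : spectral (X (k%:R / m.+1%:R)) s -> p s = p s0.
  elim: k s => [|k IH] s sP.
    apply: (step_eq 0 0) => //; first by rewrite subrr normr0 ltW.
    by rewrite mul0r in sP.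
  have [s' s'P] := spectral_exists (X (k%:R / m.+1%:R)).
  rewrite -(IH _ s'P); apply: step_eq sP => //; last exact: s'P.
  by rewrite -mulrBl -natrB // subSnn mul1r ger0_norm // invr_ge0.
symmetry; apply: (ind m.+1); by rewrite divff.
Qed.

End Flow.

Section FlowSignature.
Variables (R : realType) (E : euclidean_jordan R).
Local Notation "x ** y" := (ej_mul E x y) (at level 40, left associativity).

Lemma spectral_opp (x : E) s : spectral x s -> spectral (- x) (map -%R s).
Proof.
have sz : size (map -%R s) = size s by rewrite size_map.
have bij : bijective (cast_ord sz).
  by exists (cast_ord (esym sz)); [exact: cast_ordK | exact: cast_ordKV].
case=> e [eP eo e1] ->; exists (e \o cast_ord sz).
  split=> [k|k l|] /=; first exact: eP.
    by rewrite eo (inj_eq (bij_inj bij)).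
  by rewrite -e1 [RHS](reindex _ (onW_bij _ bij)).
rewrite -sumrN (reindex _ (onW_bij _ bij)); apply: eq_bigr => k _ /=.
by rewrite (nth_map 0) ?scaleNr // -sz.
Qed.

Lemma count_opp (s : seq R) :
  count (fun l => 0 < l) (map -%R s) = count (fun l => l < 0) s.
Proof. by rewrite count_map; apply: eq_count => l /=; rewrite oppr_gt0. Qed.

(** The curve -X solves the same linear equation, and negation exchanges the two counts. *)
Theorem flow_signature (D : {linear E -> E}) (a : E) (X : R -> E) s0 s1 :
  (forall y z, D (y ** z) = D y ** z + y ** D z) ->
  (forall (l : {scalar E}) (t : R),
    is_derive t 1 (fun s => l (X s)) (l (a ** X t + D (X t)))) ->
  spectral (X 0) s0 -> spectral (X 1) s1 ->
  (count (fun l => 0 < l) s0, count (fun l => l < 0) s0) =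
  (count (fun l => 0 < l) s1, count (fun l => l < 0) s1).
Proof.
move=> DM dX S0 S1; congr pair; first exact: (flow_pos_count DM dX S0 S1).
rewrite -!count_opp; apply: (@flow_pos_count _ _ D a (fun s => - X s)) => //; last first.
- exact: spectral_opp.
- exact: spectral_opp.
move=> l t; have h := is_deriveN (dX l t).
have -> : (fun s => l (- X s)) = - (fun s => l (X s)).
  by apply/funext => s; rewrite linearN.
by apply: (is_derive_eq h); rewrite linearN linearN -opprD linearN.
Qed.

End FlowSignature.

(** * Exponentials of endomorphisms *)

Section Exponential.
Variables (R : realType) (J : superalgebra R).
Implicit Types (f g : 'End(J)) (y : J) (l : {scalar J}).

Lemma mxpow_entry_le n (A : 'M[R]_n) k i j :
  `|(A ^+ k) i j| <= (\sum_p \sum_q `|A p q|) ^+ k.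
Proof.
set C := \sum_p _; have C0 : 0 <= C by rewrite sumr_ge0 // => p _; rewrite sumr_ge0.
elim: k i j => [|k IH] i j.
  by rewrite !expr0 mxE; case: (i == j); rewrite ?normr1 ?normr0.
rewrite exprS mxE (le_trans (ler_norm_sum _ _ _)) //.
apply: (@le_trans _ _ (\sum_q `|A i q| * C ^+ k)).
  by apply: ler_sum => q _; rewrite normrM ler_wpM2l.
rewrite -mulr_suml exprS ler_wpM2r ?exprn_ge0 // /C [X in _ <= X](bigD1 i) //= lerDl.
by rewrite sumr_ge0 // => p _; rewrite sumr_ge0.
Qed.

(** [expmx] is a [limn], meaningful only once convergence is known; each entry is dominated by the
    scalar exponential series of the sum of all absolute entries. *)
Lemma expmx_cvg n (A : 'M[R]_n) :
  series (fun k => (k`!%:R : R)^-1 *: A ^+ k) @ \oo --> expmx A.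
Proof.
set u := series _; suff : cvgn u by [].
pose v i j := series (fun k => (k`!%:R : R)^-1 * (A ^+ k) i j).
have uE m i j : u m i j = v i j m.
  by rewrite /u /v /series /= summxE; apply: eq_bigr => k _; rewrite mxE.
have vc i j : cvgn (v i j).
  apply: normed_cvg; rewrite /normed_series_of /=.
  have := is_cvg_series_exp_coeff (\sum_p \sum_q `|A p q|).
  apply: series_le_cvg => k /=; first by rewrite normr_ge0.
    rewrite /exp_coeff /= divr_ge0 // exprn_ge0 // sumr_ge0 // => p _.
    by rewrite sumr_ge0.
  rewrite normrM ger0_norm ?invr_ge0 // mulrC /exp_coeff /= ler_wpM2r ?invr_ge0 //.
  exact: mxpow_entry_le.
apply/cvg_ex; exists (\matrix_(i, j) limn (v i j)).
apply/cvg_ballP => e e0.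
have : \forall m \near \oo, forall i j, ball (limn (v i j)) e (v i j m).
  by apply: filter_forall => i; apply: filter_forall => j; have /cvg_ballP := vc i j; apply.
by apply: filterS => m H; split=> // i j; rewrite mxE uE.
Qed.

Lemma exp_end_cvg f l y :
  series (fun k => (k`!%:R : R)^-1 * l (iter k f y)) @ \oo --> l (exp_end f y).
Proof.
rewrite /exp_end; set e := vbasis _; set A := passmx.mxof e e f.
have eB : basis_of {:J} e by exact: vbasisP.
have lE (M : 'M[R]_(\dim {:J})) : l (passmx.hommx e e M y) =
    \sum_j \sum_i passmx.rVof e y 0 i * M i j * l e`_j.
  rewrite passmx.hommxE // /passmx.vecof linear_sum; apply: eq_bigr => j _.
  by rewrite linearZ /= mxE mulr_suml.
have powE k y' : passmx.hommx e e (A ^+ k) y' = iter k f y'.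
  elim: k y' => [|k IH] y'; first by rewrite expr0 passmx.hommx1 // id_lfunE.
  by rewrite exprS (passmx.hommx_mul eB eB eB) comp_lfunE IH passmx.mxofK // -iterSr.
rewrite lE.
have -> : series (fun k => (k`!%:R : R)^-1 * l (iter k f y)) =
   (fun m => \sum_j \sum_i passmx.rVof e y 0 i *
      (series (fun k => (k`!%:R : R)^-1 *: A ^+ k) m) i j * l e`_j).
  apply/funext => m; rewrite /series /=.
  under [RHS]eq_bigr do (under eq_bigr do rewrite summxE mulr_sumr mulr_suml; rewrite exchange_big).
  rewrite exchange_big; apply: eq_bigr => k _ /=; rewrite -powE lE mulr_sumr.
  apply: eq_bigr => j _; rewrite mulr_sumr; apply: eq_bigr => i _.
  have -> : (k`!%:R^-1 *: A ^+ k) i j = k`!%:R^-1 * (A ^+ k) i j by rewrite mxE.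
  by ring.
apply: cvg_big => [|j _]; first exact: add_continuous.
apply: cvg_big => [|i _]; first exact: add_continuous.
apply: cvgMr_tmp; apply: cvgMl_tmp.
exact: (cvg_comp _ (fun M : 'M[R]_(\dim {:J}) => M i j) (expmx_cvg (A := A))
  (@coord_continuous _ _ _ i j _)).
Qed.

(** The power series in s with coefficients l(f^k y) / k! has as formal derivative the same series
    for f y, so termwise differentiation applies. *)
Lemma exp_end_is_derive f l y (t : R) :
  is_derive t 1 (fun s => l (exp_end (s *: f) y)) (l (exp_end (t *: f) (f y))).
Proof.
pose c z k := (k`!%:R : R)^-1 * l (iter k f z).
have cE z s : pseries (c z) s @ \oo --> l (exp_end (s *: f) z).
  have -> : pseries (c z) s = series (fun k => (k`!%:R : R)^-1 * l (iter k (s *: f) z)).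
    rewrite /pseries; congr series; apply/funext => k; rewrite /c /= -mulrA; congr (_ * _).
    have -> : iter k (s *: f) z = s ^+ k *: iter k f z.
      elim: k => [|k IH]; first by rewrite scale1r.
      by rewrite iterS IH scale_lfunE linearZ scalerA -exprS.
    by rewrite linearZ /= mulrC.
  exact: exp_end_cvg.
have dc z : pseries_diffs (c z) = c (f z).
  apply/funext => k; rewrite /pseries_diffs /c -iterSr factS natrM invfM mulrA.
  by rewrite mulrA mulfV ?mul1r // pnatr_eq0.
have limE z : (fun s => limn (pseries (c z) s)) = (fun s => l (exp_end (s *: f) z)).
  by apply/funext => s; apply/cvg_lim => //; exact: cE.
have K : `|t| < `|(`|t| + 1 : R)| by rewrite [ltRHS]ger0_norm ?ltrDl // addr_ge0.
have := @pseries_snd_diffs R (c y) (`|t| + 1) t; rewrite !dc limE.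
have -> : limn (pseries (c (f y)) t) = l (exp_end (t *: f) (f y)).
  by apply/cvg_lim => //; exact: cE.
by apply => //; apply/cvg_ex; eexists; exact: cE.
Qed.

Lemma exp_end0 y : exp_end (0 : 'End(J)) y = y.
Proof.
apply: coord_ext => i; pose l : {scalar J} := coord (vbasis {:J}) i.
have /(cvg_lim (@Rhausdorff R)) E := @exp_end_cvg 0 l y.
rewrite -[LHS]/(l _) -[RHS]/(l _) -E.
apply/cvg_lim => //; apply: cvg_near_cst; exists 1%N => // -[//|m] _.
rewrite /series /= big_nat_recl //= fact0 invr1 mul1r big1 ?addr0 // => k _.
by rewrite zero_lfunE linear0 mulr0.
Qed.

Lemma exp_end_vanish f l y : (forall k, l (iter k f y) = 0) -> l (exp_end f y) = 0.
Proof.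
move=> H; rewrite -(cvg_lim (@Rhausdorff R) (@exp_end_cvg f l y)).
apply/cvg_lim => //; have -> : series (fun k => (k`!%:R : R)^-1 * l (iter k f y)) = cst 0.
  by apply/funext => m; rewrite /series /= big1 // => k _; rewrite H mulr0.
exact: cvg_cst.
Qed.

End Exponential.

(** * The structure algebra *)

(** The structure algebra is tested against objects of type [{vspace}], so a linear predicate must
    be realised as one. A subspace contained in it is enlarged by missing vectors until the
    dimension is exhausted. *)
Lemma vspace_of_pred (K : fieldType) (V : vectType K) (P : V -> Prop) :
  P 0 -> (forall a u v, P u -> P v -> P (a *: u + v)) ->
  exists U : {vspace V}, forall v, v \in U <-> P v.
Proof.
move=> P0 PD.
suff H n (U : {vspace V}) : (\dim {:V} - \dim U <= n)%N -> (forall u, u \in U -> P u) ->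
    exists W : {vspace V}, forall v, v \in W <-> P v.
  by apply: (H _ 0%VS (leqnn _)) => u; rewrite memv0 => /eqP->.
elim: n U => [|n IH] U Un UP.
  exists U => v; split; first exact: UP.
  have -> : U = fullv; last by rewrite memvf.
  apply/eqP; rewrite eqEdim subvf /=.
  by rewrite leqn0 subn_eq0 in Un.
have [UE|/existsNP[v /not_implyP[Pv /negP vU]]] := pselect (forall v, P v -> v \in U).
  by exists U => v; split; [exact: UP | exact: UE].
apply: (IH (U + <[v]>)%VS) => [|u /memv_addP[u1 u1U [u2 /vlineP[k ->] ->]]]; last first.
  by rewrite addrC; apply: PD => //; exact: UP.
rewrite -ltnS; apply: leq_trans Un.
have lt : (\dim U < \dim (U + <[v]>))%N.
  rewrite ltn_neqAle dimvS ?addvSl // andbT (dimv_leqif_eq (addvSl U <[v]>)).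
  by apply: contra vU => /eqP->; rewrite memvE addvSr.
have le : (\dim (U + <[v]>) <= \dim {:V})%N by rewrite dimvS ?subvf.
lia.
Qed.

Section StructureAlgebra.
Variables (R : realType) (J : superalgebra R) (beta : {biscalar J}).
Hypothesis J_jordan : jordan_superalgebra J.
Hypothesis beta_assoc : forall a b c, beta (jmul J a b) c = beta a (jmul J b c).
Implicit Types (a b c x y : J) (f g D : 'End(J)) (i j k l : bool).

Local Notation "x ** y" := (jmul J x y) (at level 40, left associativity).
Local Notation "''s_' b" := ((-1) ^+ (nat_of_bool b)) (at level 8, b at level 2, format "''s_' b").

Let betaBZl x y z (t : R) : beta (x - t *: y) z = beta x z - t * beta y z.
Proof. by rewrite linearBl; congr (_ - _); exact: linearZl_LR. Qed.

Let betaBZr x y z (t : R) : beta z (x - t *: y) = beta z x - t * beta z y.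
Proof. by rewrite linearBr; congr (_ - _); exact: linearZr_LR. Qed.

Lemma superbracketE i j f g x :
  superbracket i j f g x = f (g x) - 's_(i && j) *: g (f x).
Proof. by rewrite /superbracket add_lfunE opp_lfunE scale_lfunE !comp_lfunE. Qed.

Lemma LmulE a x : Lmul a x = a ** x.
Proof. by rewrite /Lmul lfunE. Qed.

Lemma part_decomp x :
  exists2 x0, x0 \in part J false & exists2 x1, x1 \in part J true & x = x0 + x1.
Proof.
have : x \in (part J false + part J true)%VS by rewrite part_sum memvf.
by case/memv_addP => x0 ? [x1 ? ?]; exists x0 => //; exists x1.
Qed.

Lemma part_inter0 j x : x \in part J j -> x \in part J (~~ j) -> x = 0.
Proof.
move=> xj xj'; apply/eqP; rewrite -memv0 -(part_direct J) memv_cap.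
by case: j xj xj' => /= -> ->.
Qed.

Lemma gl_partP i f : gl_part i f <-> forall j x, x \in part J j -> f x \in part J (i (+) j).
Proof.
split=> H j; first by move=> x xj; apply: (subvP (H j)); exact: memv_img.
by apply/subvP => _ /memv_imgP[x xj ->]; exact: H.
Qed.

Lemma gl_part_Lmul i a : a \in part J i -> gl_part i (Lmul a).
Proof. by move=> ai; apply/gl_partP => j x xj; rewrite LmulE jmul_part. Qed.

Lemma gl_partD i f g : gl_part i f -> gl_part i g -> gl_part i (f + g).
Proof.
by move=> /gl_partP F /gl_partP G; apply/gl_partP => j x xj; rewrite add_lfunE memvD ?F ?G.
Qed.

Lemma gl_partZ i (k : R) f : gl_part i f -> gl_part i (k *: f).
Proof.
by move=> /gl_partP F; apply/gl_partP => j x xj; rewrite scale_lfunE memvZ ?F.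
Qed.

Lemma gl_part_comp i j f g : gl_part i f -> gl_part j g -> gl_part (i (+) j) (f \o g)%VF.
Proof.
move=> /gl_partP F /gl_partP G; apply/gl_partP => l x xl.
by rewrite comp_lfunE -addbA F ?G.
Qed.

Lemma gl_part_bracket i j f g :
  gl_part i f -> gl_part j g -> gl_part (i (+) j) (superbracket i j f g).
Proof.
move=> F G; rewrite /superbracket -scaleN1r; apply: gl_partD; first exact: gl_part_comp.
by do 2!apply: gl_partZ; rewrite addbC; apply: gl_part_comp.
Qed.

Definition skew_derivation i D := [/\ gl_part i D,
  forall j a b, a \in part J j -> D (a ** b) = D a ** b + 's_(i && j) *: (a ** D b) &
  forall j a b, a \in part J j -> beta (D a) b = - ('s_(i && j) * beta a (D b))].

Lemma skew_derivation0 i : skew_derivation i 0.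
Proof.
split=> [|j a b _|j a b _]; first by apply/gl_partP => j x _; rewrite zero_lfunE mem0v.
  by rewrite !zero_lfunE linear0l linear0r scaler0 addr0.
by rewrite !zero_lfunE linear0l linear0r mulr0 oppr0.
Qed.

Lemma skew_derivationP i (k : R) D D' :
  skew_derivation i D -> skew_derivation i D' -> skew_derivation i (k *: D + D').
Proof.
move=> [gD dD sD] [gD' dD' sD']; split=> [|j a b aj|j a b aj].
- by apply: gl_partD => //; exact: gl_partZ.
- rewrite !add_lfunE !scale_lfunE (dD j) // (dD' j) //.
  rewrite linearDl linearDr /= linearZl_LR linearZr_LR /=.
  by rewrite !scalerDr !scalerA [k * _]mulrC addrACA.
- rewrite !add_lfunE !scale_lfunE linearDl linearDr /= linearZl_LR linearZr_LR /=.
  rewrite (sD j) // (sD' j) //.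
  ring.
Qed.

Lemma skew_derivation_bracket i j D D' :
  skew_derivation i D -> skew_derivation j D' -> skew_derivation (i (+) j) (superbracket i j D D').
Proof.
move=> [gD dD sD] [gD' dD' sD']; split=> [|k a b ak|k a b ak]; first exact: gl_part_bracket.
  have /gl_partP/(_ k a ak) aD := gD; have /gl_partP/(_ k a ak) aD' := gD'.
  rewrite !superbracketE (dD k) // (dD' k) // !(linearD, linearZ) /=.
  rewrite (dD _ _ _ aD') (dD' _ _ _ aD) (dD _ _ _ ak) (dD' _ _ _ ak).
  rewrite ?(linearDl, linearDr, linearNl, linearNr, linearZl_LR, linearZr_LR) /=.
  apply: coord_ext => n; rewrite !coordE.
  by case: i j k {dD dD' sD sD' gD gD' ak aD aD'} => [] [] [] /=; rewrite ?expr0 ?expr1; ring.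
have /gl_partP/(_ k a ak) aD := gD; have /gl_partP/(_ k a ak) aD' := gD'.
rewrite !superbracketE betaBZl betaBZr (sD _ _ _ aD') (sD' _ _ _ aD) (sD _ _ _ ak) (sD' _ _ _ ak).
by case: i j k {dD dD' sD sD' gD gD' ak aD aD'} => [] [] [] /=; rewrite ?expr0 ?expr1; ring.
Qed.

Let scomm : forall i j a b, a \in part J i -> b \in part J j -> a ** b = 's_(i && j) *: (b ** a).
Proof. by case: J_jordan. Qed.

Lemma super_jordan i j k a b c d :
  a \in part J i -> b \in part J j -> c \in part J k ->
  a ** ((b ** c) ** d) - 's_(i && (j (+) k)) *: ((b ** c) ** (a ** d)) =
  (a ** b) ** (c ** d) - 's_((i (+) j) && k) *: (c ** ((a ** b) ** d))
  - 's_(i && j) *: (b ** ((a ** c) ** d) - 's_(j && (i (+) k)) *: ((a ** c) ** (b ** d))).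
Proof.
move=> ai bj ck; have [_ H] := J_jordan.
have := congr1 (fun f : 'End(J) => f d) (H i j k a b c ai bj ck).
by rewrite add_lfunE opp_lfunE scale_lfunE !superbracketE !LmulE.
Qed.

(** A signed difference of two super Jordan identities, with [a] and [d] exchanged. The equations
    from [c1] to [c9''] bring the products to a common form by supercommutativity; the signs are
    settled in the sixteen parity cases. *)
Lemma Lmul_bracket_homog i j k l a b c d :
  a \in part J i -> d \in part J j -> b \in part J k -> c \in part J l ->
  superbracket i j (Lmul a) (Lmul d) (b ** c) =
  superbracket i j (Lmul a) (Lmul d) b ** c
  + 's_((i (+) j) && k) *: (b ** superbracket i j (Lmul a) (Lmul d) c).
Proof.
move=> ai dj bk cl; rewrite !superbracketE !LmulE.
have H1 := super_jordan d ai bk cl; have H2 := super_jordan a dj bk cl.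
have c1 := congr1 (jmul J a) (scomm (jmul_part bk cl) dj).
have c2 := congr1 (jmul J d) (scomm (jmul_part bk cl) ai).
have c3 := congr1 (jmul J (b ** c)) (scomm dj ai).
have c4 := congr1 (jmul J c) (scomm (jmul_part ai bk) dj).
have c4' := scomm cl (jmul_part dj (jmul_part ai bk)).
have c5 := congr1 (jmul J c) (scomm (jmul_part dj bk) ai).
have c5' := scomm cl (jmul_part ai (jmul_part dj bk)).
have c6 := congr1 (jmul J b) (scomm (jmul_part ai cl) dj).
have c7 := congr1 (jmul J b) (scomm (jmul_part dj cl) ai).
have c8 := scomm (jmul_part dj bk) (jmul_part cl ai).
have c8' := congr1 (fun z => z ** (d ** b)) (scomm cl ai).
have c8'' := congr1 (jmul J (a ** c)) (scomm dj bk).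
have c9 := scomm (jmul_part dj cl) (jmul_part bk ai).
have c9' := congr1 (fun z => z ** (d ** c)) (scomm bk ai).
have c9'' := congr1 (jmul J (a ** b)) (scomm dj cl).
move: H1 H2 c1 c2 c3 c4 c4' c5 c5' c6 c7 c8 c8' c8'' c9 c9' c9'' => /=.
rewrite ?linearBl ?linearBr /= ?linearZl_LR ?linearZr_LR /=.
move=> H1 H2 c1 c2 c3 c4 c4' c5 c5' c6 c7 c8 c8' c8'' c9 c9' c9''.
apply: coord_ext => n; set phi := coord _ n.
move: (congr1 phi H1) (congr1 phi H2) (congr1 phi c1) (congr1 phi c2) (congr1 phi c3)
  (congr1 phi c4) (congr1 phi c4') (congr1 phi c5) (congr1 phi c5') (congr1 phi c6)
  (congr1 phi c7) (congr1 phi c8) (congr1 phi c8') (congr1 phi c8'') (congr1 phi c9)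
  (congr1 phi c9') (congr1 phi c9'').
clear H1 H2 c1 c2 c3 c4 c4' c5 c5' c6 c7 c8 c8' c8'' c9 c9' c9''.
rewrite /phi !coordE => {phi}.
by case: i ai => _; case: j dj => _; case: k bk => _; case: l cl => _ /=;
  rewrite ?expr0 ?expr1; lra.
Qed.

(** For skewness: an associative form makes each left multiplication self-adjoint up to sign, so
    taking adjoints reverses the composition of two of them. *)
Lemma skew_derivation_Lmul i j a d : a \in part J i -> d \in part J j ->
  skew_derivation (i (+) j) (superbracket i j (Lmul a) (Lmul d)).
Proof.
move=> ai dj; split=> [|k b c bk|k b c bk].
- by apply: gl_part_bracket; apply: gl_part_Lmul.
- have [c0 c0P [c1 c1P ->]] := part_decomp c.
  rewrite linearDr /= linearD /= (Lmul_bracket_homog ai dj bk c0P).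
  rewrite (Lmul_bracket_homog ai dj bk c1P).
  have -> : superbracket i j (Lmul a) (Lmul d) (c0 + c1) =
    superbracket i j (Lmul a) (Lmul d) c0 + superbracket i j (Lmul a) (Lmul d) c1 by exact: linearD.
  rewrite !linearDr /=.
  by rewrite scalerDr addrACA.
have e1 : beta (a ** (d ** b)) c = 's_(i && (j (+) k)) * ('s_(j && k) * beta b (d ** (a ** c))).
  rewrite (scomm ai (jmul_part dj bk)) (scomm dj bk) !linearZl_LR /=.
  by rewrite !beta_assoc.
have e2 : beta (d ** (a ** b)) c = 's_(j && (i (+) k)) * ('s_(i && k) * beta b (a ** (d ** c))).
  rewrite (scomm dj (jmul_part ai bk)) (scomm ai bk) !linearZl_LR /=.
  by rewrite !beta_assoc.
rewrite !superbracketE betaBZl betaBZr !LmulE e1 e2.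
by case: i j k {ai dj bk e1 e2} => [] [] [] /=; rewrite ?expr0 ?expr1; ring.
Qed.

(* The parity-[i] component of [L_J + Der(J, beta)], a Lie superalgebra that
   contains [g(J)]. *)
Definition skew_structure i f := exists a D,
  [/\ a \in part J i, skew_derivation i D & f = Lmul a + D].

Lemma LmulP (t : R) a b : Lmul (t *: a + b) = t *: Lmul a + Lmul b.
Proof.
apply/lfunP => x; rewrite add_lfunE scale_lfunE !LmulE linearDl /=.
by congr (_ + _); exact: linearZl_LR.
Qed.

Lemma skew_structure_gl i f : skew_structure i f -> gl_part i f.
Proof. by move=> [a [D [ai [gD _ _] ->]]]; apply: gl_partD => //; exact: gl_part_Lmul. Qed.

Lemma skew_structure0 i : skew_structure i 0.
Proof.
exists 0, 0; split; rewrite ?mem0v //; first exact: skew_derivation0.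
by apply/lfunP => x; rewrite add_lfunE !zero_lfunE LmulE linear0l addr0.
Qed.

Lemma skew_structureP i (t : R) f g :
  skew_structure i f -> skew_structure i g -> skew_structure i (t *: f + g).
Proof.
move=> [a [D [ai dD ->]]] [b [D' [bi dD' ->]]].
exists (t *: a + b), (t *: D + D'); split; first by rewrite memvD ?memvZ.
  exact: skew_derivationP.
by rewrite LmulP scalerDr addrACA.
Qed.

Lemma derivation_bracket_Lmul i j D a : skew_derivation i D -> a \in part J j ->
  superbracket i j D (Lmul a) = Lmul (D a).
Proof.
move=> [_ dD _] aj; apply/lfunP => x.
by rewrite superbracketE !LmulE (dD _ _ _ aj) addrK.
Qed.

Lemma superbracketC i j f g :
  superbracket i j f g = - 's_(i && j) *: superbracket j i g f.
Proof.
rewrite /superbracket scalerBr scalerA andbC mulNr -signr_addb addbb expr0 scaleN1r opprK.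
by rewrite addrC scaleNr.
Qed.

(** [L_a + D, L_b + D'] has multiplication part D b - (-1)^(ij) D' a and derivation part [L_a, L_b]
    + [D, D']. *)
Lemma skew_structure_bracket i j f g : skew_structure i f -> skew_structure j g ->
  skew_structure (i (+) j) (superbracket i j f g).
Proof.
move=> [a [D [ai dD ->]]] [b [D' [bj dD' ->]]].
have [/gl_partP gD _ _] := dD; have [/gl_partP gD' _ _] := dD'.
exists (D b - 's_(i && j) *: D' a),
  (1 *: superbracket i j (Lmul a) (Lmul b) + superbracket i j D D').
split.
- by rewrite memvB ?memvZ ?gD // addbC gD'.
- by apply: skew_derivationP; [exact: skew_derivation_Lmul | exact: skew_derivation_bracket].
- have E1 := derivation_bracket_Lmul dD bj.
  have E2 := superbracketC i j (Lmul a) D'.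
  rewrite (derivation_bracket_Lmul dD' ai) in E2.
  apply/lfunP => x; have e1 := congr1 (fun h : 'End(J) => h x) E1.
  have e2 := congr1 (fun h : 'End(J) => h x) E2.
  rewrite ?scale_lfunE !superbracketE !LmulE in e1 e2.
  have e3 : superbracket i j (Lmul a) (Lmul b) x = a ** (b ** x) - 's_(i && j) *: (b ** (a ** x)).
    by rewrite superbracketE !LmulE.
  have e4 := superbracketE i j D D' x.
  rewrite superbracketE scale1r; move: (superbracket i j (Lmul a) (Lmul b)) e3 => B1 e3.
  move: (superbracket i j D D') e4 => B2 e4.
  rewrite !(add_lfunE, LmulE) e3 e4.
  rewrite !(linearDr, linearD) /= [(D b + _) ** x]linearDl linearNl linearZl_LR /=.
  apply: coord_ext => n.
  have := congr1 (coord (vbasis {:J}) n) e1; have := congr1 (coord (vbasis {:J}) n) e2.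
  rewrite !coordE; lra.
Qed.

Definition in_skew_structure f := exists f0 f1,
  [/\ skew_structure false f0, skew_structure true f1 & f = f0 + f1].

Lemma in_skew_structure_homog i f : in_skew_structure f -> gl_part i f -> skew_structure i f.
Proof.
have gl0 j (h : 'End(J)) : gl_part j h -> gl_part (~~ j) h -> h = 0.
  move=> /gl_partP H /gl_partP H'; apply/lfunP => x; rewrite zero_lfunE.
  have z k y : y \in part J k -> h y = 0.
    by move=> yk; apply: (part_inter0 (j := j (+) k)); rewrite -?addNb; [exact: H|exact: H'].
  have [x0 x0P [x1 x1P ->]] := part_decomp x.
  by rewrite linearD /= (z _ _ x0P) (z _ _ x1P) addr0.
have gN j (h : 'End(J)) : gl_part j h -> gl_part j (- h).
  by move=> H; rewrite -scaleN1r; exact: gl_partZ.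
move=> [f0 [f1 [F0 F1 ->]]]; have G0 := skew_structure_gl F0; have G1 := skew_structure_gl F1.
case: i => G.
  suff -> : f0 = 0 by rewrite add0r.
  apply: (gl0 false) => //=; have -> : f0 = (f0 + f1) + (- f1) by rewrite addrK.
  by apply: gl_partD => //; exact: gN.
suff -> : f1 = 0 by rewrite addr0.
apply: (gl0 true) => //=; have -> : f1 = (f0 + f1) + (- f0) by rewrite addrAC subrr add0r.
by apply: gl_partD => //; exact: gN.
Qed.

Lemma structure_algebra_even_skew f : structure_algebra_even f -> skew_structure false f.
Proof.
case=> fS f0; apply: (in_skew_structure_homog _ f0).
have [U UP] : exists U : {vspace 'End(J)}, forall f, f \in U <-> in_skew_structure f.
  apply: vspace_of_pred.
    by exists 0, 0; split; rewrite ?addr0 //; exact: skew_structure0.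
  move=> t u v [u0 [u1 [u0P u1P ->]]] [v0 [v1 [v0P v1P ->]]].
  exists (t *: u0 + v0), (t *: u1 + v1); split; try exact: skew_structureP.
  by rewrite scalerDr addrACA.
have skewU i h : skew_structure i h -> h \in U.
  move=> H; apply/UP; case: i H => H.
    by exists 0, h; split; rewrite ?add0r //; exact: skew_structure0.
  by exists h, 0; split; rewrite ?addr0 //; exact: skew_structure0.
apply/UP; apply: fS => [|a].
  split=> [h /UP[h0 [h1 [H0 H1 ->]]]|i j h g /UP hU /UP gU hi gj].
    exists h0, h1; split=> //; by [exact: skewU H0|exact: skewU H1|exact: skew_structure_gl].
  apply: (skewU (i (+) j)); apply: skew_structure_bracket; exact: in_skew_structure_homog.
have [a0 a0P [a1 a1P ->]] := part_decomp a.
rewrite -[a0]scale1r LmulP scale1r memvD //.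
  apply: (skewU false); exists a0, 0; split => //; first exact: skew_derivation0.
  by rewrite addr0.
apply: (skewU true); exists a1, 0; split => //; first exact: skew_derivation0.
by rewrite addr0.
Qed.

End StructureAlgebra.

(** * The even part as a Euclidean Jordan algebra *)

Section EvenPart.
Variables (R : realType) (J : superalgebra R).
Local Notation J0 := (part J false).
Local Notation V := (subvs_of J0).
Local Notation "x ** y" := (jmul J x y) (at level 40, left associativity).

Definition even_mul (x y : V) : V := vsproj J0 (vsval x ** vsval y).

Lemma even_mulE x y : vsval (even_mul x y) = vsval x ** vsval y.
Proof. by rewrite vsprojK //; have := jmul_part (subvsP x) (subvsP y). Qed.

Lemma even_mul_bilinear : bilinear_for
  (GRing.Scale.Law.clone _ _ *:%R _) (GRing.Scale.Law.clone _ _ *:%R _) even_mul.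
Proof.
split=> [y|x] a u v /=; rewrite /even_mul linearP /=.
  by rewrite linearDl /= linearZl_LR linearP.
by rewrite linearP.
Qed.

HB.instance Definition _ := bilinear_isBilinear.Build R V V V _ _ even_mul even_mul_bilinear.

Definition even_form (x y : V) : R := tau (vsval x) (vsval y).

Lemma tauE (x y : J) : tau x y =
  \sum_(k < \dim J0) coord (vbasis J0) k ((x ** y) ** (vbasis J0)`_k).
Proof. by apply: eq_bigr => k _; rewrite LmulE. Qed.

Lemma even_form_bilinear : bilinear_for
  (GRing.Scale.Law.clone _ _ *%R _) (GRing.Scale.Law.clone _ _ *%R _) even_form.
Proof.
split=> [y|x] a u v /=; rewrite /even_form !tauE mulr_sumr -big_split /=;
  apply: eq_bigr => k _.
  by rewrite !linearPl linearP.
by rewrite linearPr linearPl linearP.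
Qed.

HB.instance Definition _ := bilinear_isBilinear.Build R V V R _ _ even_form even_form_bilinear.

Hypothesis J_jordan : jordan_superalgebra J.
Hypothesis J_unital : unital J.
Hypothesis J_pos : positive_even_part J.

Lemma even_mulC x y : even_mul x y = even_mul y x.
Proof.
apply: val_inj; rewrite /= !even_mulE; have [H _] := J_jordan.
by rewrite (H _ _ _ _ (subvsP x) (subvsP y)) /= expr0 scale1r.
Qed.

(** For the odd component u_1 of the unit and homogeneous x, the element u_1 x = x - u_0 x has both
    parities, hence is zero; then u_1 = u_1 u = 0. *)
Lemma even_unit : exists u, u \in J0 /\ is_unit u.
Proof.
have [u uP] := J_unital; have [u0 u0P [u1 u1P uE]] := part_decomp u.
suff u10 : u1 = 0 by exists u0; split=> //; move: uP; rewrite uE u10 addr0.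
have H j x : x \in part J j -> u1 ** x = 0.
  move=> xj; have [ux _] := uP x; move: ux; rewrite uE linearDl /= => ux.
  have e : u1 ** x = x - u0 ** x by rewrite -[X in _ = X - _]ux addrAC subrr add0r.
  apply: (@part_inter0 R J j); last by have := jmul_part u1P xj.
  by rewrite e; apply: memvB => //; have := jmul_part u0P xj.
have [_ u1u] := uP u1; rewrite -u1u uE linearDr /=.
by rewrite (H _ _ u0P) (H _ _ u1P) addr0.
Qed.

Definition even_one : V := vsproj J0 (projT1 (cid even_unit)).

Lemma even_oneE : is_unit (vsval even_one).
Proof. by rewrite /even_one; case: cid => u [uJ uP] /=; rewrite vsprojK. Qed.

Lemma even_mul1 x : even_mul even_one x = x.
Proof. by apply: val_inj; rewrite /= even_mulE; case: (even_oneE (vsval x)). Qed.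

Lemma even_jordan_identity a b c d :
  even_mul a (even_mul (even_mul b c) d) - even_mul (even_mul b c) (even_mul a d) =
  even_mul (even_mul a b) (even_mul c d) - even_mul c (even_mul (even_mul a b) d)
  - (even_mul b (even_mul (even_mul a c) d) - even_mul (even_mul a c) (even_mul b d)).
Proof.
apply: val_inj; rewrite /= !(linearB, even_mulE) /=.
have := super_jordan J_jordan (vsval d) (subvsP a) (subvsP b) (subvsP c).
by rewrite /= expr0 !scale1r => ->; rewrite opprD.
Qed.

Lemma even_formC x y : even_form x y = even_form y x.
Proof. by rewrite /even_form !tauE -!even_mulE even_mulC. Qed.

Lemma even_formA x y z : even_form (even_mul x y) z = even_form x (even_mul y z).
Proof. by have [H _] := J_pos; rewrite /even_form !even_mulE H ?subvsP. Qed.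

Lemma even_form_gt0 x : x != 0 -> 0 < even_form x x.
Proof.
move=> x0; have [_ H] := J_pos; apply: H; first exact: subvsP.
by apply: contraNneq x0 => e; apply/eqP; apply: val_inj; rewrite /= e.
Qed.

(** The form is the trace form [tau]: positivity is required, and [beta] may be indefinite on
    J_0. *)
Definition even_jordan : euclidean_jordan R :=
  @EuclideanJordan R V even_mul even_one even_form even_mulC even_mul1
    even_jordan_identity even_formC even_formA even_form_gt0.

Lemma is_unit_uniq u v : is_unit u -> is_unit v -> u = v :> J.
Proof. by move=> /(_ v)[uv _] /(_ u)[_ uv']; rewrite -uv' uv. Qed.

Lemma even_idem (x : even_jordan) : idem x <-> idempotent0 (vsval x).
Proof.
rewrite /idem /idempotent0 /= -even_mulE; split=> [xx|[_ xx]].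
  by split; [exact: subvsP | congr vsval].
exact: val_inj.
Qed.

Let vsval_inj (x y : even_jordan) : vsval x = vsval y -> x = y.
Proof. exact: val_inj. Qed.

Let vsvalD (x y : even_jordan) : vsval (x + y) = vsval x + vsval y.
Proof. exact: (linearD (@vsval _ _ J0)). Qed.

Let vsvalZ (t : R) (x : even_jordan) : vsval (t *: x) = t *: vsval x.
Proof. exact: (@linearZZ _ _ _ (@vsval _ _ J0) t x). Qed.

Let vsval_sum n (F : 'I_n -> even_jordan) : vsval (\sum_k F k) = \sum_k vsval (F k).
Proof. exact: (linear_sum (@vsval _ _ J0)). Qed.

Lemma vsval_eq0 (x : V) : (vsval x == 0) = (x == 0).
Proof. by rewrite -[X in vsval x == X](linear0 (@vsval _ _ J0)) (inj_eq val_inj). Qed.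

Lemma even_primitive (x : even_jordan) : eprimitive x <-> primitive (vsval x).
Proof.
split=> -[xx x0 xP]; split; rewrite ?vsval_eq0 //.
- exact/even_idem.
- move=> [y [z [[yJ yy] [zJ zz] y0 z0 xE]]]; apply: xP.
  exists (vsproj J0 y), (vsproj J0 z).
  split; try (by apply/even_idem; rewrite /= vsprojK); try by rewrite -vsval_eq0 vsprojK.
  by apply: vsval_inj; rewrite vsvalD !vsprojK.
- exact/even_idem.
- move=> [y [z [/even_idem yy /even_idem zz y0 z0 xE]]]; apply: xP.
  by exists (vsval y), (vsval z); rewrite !vsval_eq0 xE vsvalD.
Qed.

Lemma even_spectral (x : even_jordan) s :
  spectral x s <-> spectral_decomposition (vsval x) s.
Proof.
split.
  move=> [e [eP eo e1] xE]; exists (vsval \o e).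
    split=> [k|k l|] /=; first exact/even_primitive.
      by rewrite -even_mulE [even_mul _ _]eo; case: eqP => // _; rewrite linear0.
    rewrite -vsval_sum e1; exact: even_oneE.
  rewrite xE vsval_sum; apply: eq_bigr => k _; exact: vsvalZ.
move=> [e [eP eo e1] xE].
have eJ k : e k \in J0 by case: (eP k) => -[].
exists (fun k => vsproj J0 (e k)).
  split=> [k|k l|].
  - by apply/even_primitive; rewrite /= vsprojK.
  - apply: vsval_inj; rewrite even_mulE !vsprojK // eo.
    by case: eqP => _; rewrite ?linear0 // vsprojK.
  - apply: vsval_inj; rewrite vsval_sum.
    rewrite (eq_bigr e) => [|k _]; last by rewrite vsprojK.
    exact: is_unit_uniq e1 even_oneE.
apply: vsval_inj; rewrite xE vsval_sum; apply: eq_bigr => k _.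
by rewrite vsvalZ vsprojK.
Qed.

(** Existence of a decomposition rules out a fallback of [xget] to its default [[::]]. *)
Lemma spectral_coefficientsP (x : even_jordan) :
  spectral x (spectral_coefficients (vsval x)).
Proof.
apply/even_spectral; rewrite /spectral_coefficients.
have [s /even_spectral sP] := spectral_exists x.
exact: (@xgetPex _ [::] [set s | spectral_decomposition (vsval x) s] (ex_intro _ s sP)).
Qed.

End EvenPart.

(** * The identification of J with its dual *)

Section Sharp.
Variables (R : realType) (J : superalgebra R) (beta : {biscalar J}).
Hypothesis beta_nondeg : forall a, (forall b, beta a b = 0) -> a = 0.

Let flat_fun (x : J) : 'Hom(J, R^o) := linfun (beta x : J -> R^o).

Let flat_funE x y : flat_fun x y = beta x y.
Proof. by rewrite lfunE. Qed.

Let flat_fun_linear : linear flat_fun.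
Proof.
move=> a x y; apply/lfunP => z; rewrite add_lfunE scale_lfunE !flat_funE linearDl /=.
by congr (_ + _); exact: linearZl_LR.
Qed.

HB.instance Definition _ := GRing.isLinear.Build R J 'Hom(J, R^o) _ flat_fun flat_fun_linear.

Lemma flatE x y : flat beta x y = beta x y.
Proof. by rewrite /flat -[linfun _]/(linfun flat_fun) lfunE /= flat_funE. Qed.

(** Nondegeneracy makes [flat] injective, and equality of dimensions makes it surjective. *)
Lemma sharpK xi : flat beta (sharp beta xi) = xi.
Proof.
apply: limg_lfunVK; suff -> : limg (flat beta) = fullv by rewrite memvf.
have ker0 : (fullv :&: lker (flat beta) = 0)%VS.
  apply/eqP; rewrite capfv -subv0; apply/subvP => x; rewrite memv_ker memv0 => /eqP x0.
  by apply/eqP; apply: beta_nondeg => b; rewrite -flatE x0 zero_lfunE.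
have := limg_ker_dim (flat beta) fullv; rewrite ker0 dimv0 add0n => e.
by apply/eqP; rewrite eqEdim subvf /= e !dimvf /dim /= muln1.
Qed.

Lemma sharpE xi y : beta (sharp beta xi) y = xi y.
Proof. by rewrite -flatE sharpK. Qed.

End Sharp.

(** * Orbits as linear flows on the even part *)

Section Invariance.
Variables (R : realType) (J : superalgebra R) (beta : {biscalar J}).
Hypothesis J_jordan : jordan_superalgebra J.
Hypothesis J_unital : unital J.
Hypothesis J_beta : pseudo_euclidean beta.
Hypothesis J_pos : positive_even_part J.
Local Notation J0 := (part J false).
Local Notation E := (even_jordan J_jordan J_unital J_pos).

Let beta_nondeg a : (forall b, beta a b = 0) -> a = 0.
Proof. by case: J_beta => _ _ + _; apply. Qed.

Let beta_even a b : a \in J0 -> b \in part J true -> beta a b = 0 /\ beta b a = 0.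
Proof. by case: J_beta => + _ _ _; apply. Qed.

Let beta_sym a b : a \in J0 -> b \in J0 -> beta a b = beta b a.
Proof.
by case: J_beta => _ + _ _ => /(_ false false a b) H aJ bJ; rewrite H // expr0 mul1r.
Qed.

Let beta_assoc a b c : beta (jmul J a b) c = beta a (jmul J b c).
Proof. by case: J_beta => _ _ _; apply. Qed.

Lemma sharp_even (xi : 'Hom(J, R^o)) : even_dual xi -> sharp beta xi \in J0.
Proof.
move=> xi0; have [x0 x0P [x1 x1P xE]] := part_decomp (sharp beta xi).
suff x10 : x1 = 0 by rewrite xE x10 addr0.
apply: beta_nondeg => b; have [b0 b0P [b1 b1P ->]] := part_decomp b.
rewrite linearDr /= (beta_even b0P x1P).2 add0r.
have e : beta (sharp beta xi) b1 = 0 by rewrite sharpE // xi0.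
by move: e; rewrite xE linearDl /= (beta_even x0P b1P).1 add0r.
Qed.

(** The functional is extended to J by the projection and represented by [beta]; as [beta] is even,
    the odd component of the representing vector is orthogonal to J_0. *)
Lemma even_functional (l : {scalar E}) :
  exists2 y : J, y \in J0 & forall v : E, l v = beta (vsval v) y.
Proof.
pose L (z : J) : R^o := l (vsproj J0 z).
have L_linear : linear L by move=> t u v; rewrite /L linearP; exact: (linearP l).
pose Llin : {linear J -> R^o} := HB.pack L (GRing.isLinear.Build R J R^o _ L L_linear).
have [y0 y0P [y1 y1P yE]] := part_decomp (sharp beta (linfun Llin)).
exists y0 => // v; have vJ : vsval v \in J0 by exact: subvsP.
have := sharpE beta_nondeg (linfun Llin) (vsval v).
rewrite lfunE /= /L vsvalK yE linearDl /= (beta_even vJ y1P).2 addr0 => <-.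
exact: beta_sym.
Qed.

Lemma iter_part (f : 'End(J)) y i k : gl_part false f -> y \in part J i -> iter k f y \in part J i.
Proof.
move=> /gl_partP H yi; elim: k => //= k IH; have := H _ _ IH.
by rewrite addFb.
Qed.

Lemma exp_even_dual (f : 'End(J)) (xi : 'Hom(J, R^o)) : gl_part false f -> even_dual xi ->
  even_dual (xi \o exp_end f)%VF.
Proof.
move=> f0 xi0 y yJ; rewrite comp_lfunE -(sharpE beta_nondeg).
apply: (@exp_end_vanish _ _ f (beta (sharp beta xi))) => k.
by apply: etrans (sharpE beta_nondeg _ _) _; rewrite xi0 // iter_part.
Qed.

Lemma exp_signature (f : 'End(J)) (xi : 'Hom(J, R^o)) : structure_algebra_even f -> even_dual xi ->
  spectral_signature beta (xi \o exp_end f)%VF = spectral_signature beta xi.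
Proof.
move=> fS xi0; have f0 : gl_part false f by case: fS.
have [a [D [aJ [/gl_partP DJ dD sD] fE]]] := structure_algebra_even_skew J_jordan beta_assoc fS.
pose x (t : R) := sharp beta (xi \o exp_end (t *: f))%VF.
have xJ t : x t \in J0 by apply: sharp_even; apply: exp_even_dual => //; exact: gl_partZ.
pose X (t : R) : E := vsproj J0 (x t).
have XE t : vsval (X t) = x t by rewrite vsprojK.
(* The sign comes from the dual action: for [beta] the derivation is skew and the multiplication
   self-adjoint, so f = L_a + D acts on [x t] as L_a - D. *)
pose DE (v : E) : E := vsproj J0 (- D (vsval v)).
have DEE v : vsval (DE v) = - D (vsval v) by rewrite vsprojK // memvN (DJ false) // subvsP.
have DE_linear : linear DE.
  move=> t u v.
  have e : vsval (t *: u + v) = t *: vsval u + vsval v := linearP (@vsval _ _ J0) t u v.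
  by rewrite /DE e linearP opprD -scalerN; exact: linearP.
pose DL : {linear E -> E} := HB.pack DE (GRing.isLinear.Build R E E _ DE DE_linear).
have DM (y z : E) : DL (ej_mul E y z) = ej_mul E (DL y) z + ej_mul E y (DL z).
  apply: val_inj; rewrite [LHS]DEE [vsval (ej_mul E y z)]even_mulE.
  have yJ := subvsP y; have zJ := subvsP z.
  rewrite (dD _ _ _ yJ) /= expr0 scale1r opprD.
  transitivity (vsval (even_mul (DE y) z) + vsval (even_mul y (DE z))).
    by rewrite !even_mulE !DEE linearNl linearNr.
  exact: esym (linearD (@vsval _ _ J0) _ _).
have dX (l : {scalar E}) (t : R) : is_derive t 1 (fun s => l (X s))
    (l (ej_mul E (vsproj J0 a) (X t) + DL (X t))).
  have [y yJ lE] := even_functional l.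
  have lXE s : l (X s) = beta (sharp beta xi) (exp_end (s *: f) y).
    transitivity ((xi \o exp_end (s *: f))%VF y); first by rewrite lE XE; exact: sharpE.
    by rewrite comp_lfunE; apply: esym; exact: sharpE.
  have -> : (fun s => l (X s)) = (fun s => beta (sharp beta xi) (exp_end (s *: f) y)).
    by apply/funext => s; exact: lXE.
  apply: (is_derive_eq (exp_end_is_derive f (beta (sharp beta xi)) y t)) => /=.
  (* In the derivative [f] acts first, on [y], so the remaining factor exp(t f) is absorbed into
     [x t]. *)
  transitivity (beta (x t) (f y)).
    apply: etrans (sharpE beta_nondeg _ _) _; apply: etrans (esym (sharpE beta_nondeg _ _)).
    by rewrite comp_lfunE.
  rewrite {1}fE add_lfunE LmulE.
  have vE : vsval (ej_mul E (vsproj J0 a) (X t) + DL (X t)) = jmul J a (x t) - D (x t).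
    transitivity (vsval (even_mul (vsproj J0 a) (X t)) + vsval (DE (X t))).
      exact: (linearD (@vsval _ _ J0)).
    by rewrite even_mulE DEE XE vsprojK.
  apply: etrans (esym (lE _)); apply: etrans (congr1 (fun z => beta z y) (esym vE)).
  rewrite linearDr linearDl linearNl /=.
  congr (_ + _); last by rewrite (sD _ _ _ (xJ t)) /= expr0 mul1r opprK.
  rewrite -beta_assoc; have [H _] := J_jordan.
  by rewrite (H _ _ _ _ (xJ t) aJ) /= expr0 scale1r.
have P t : spectral (X t) (spectral_coefficients (x t)).
  by rewrite -XE; exact: spectral_coefficientsP.
have := flow_signature DM dX (P 0) (P 1).
rewrite /x scale0r scale1r; have -> : (xi \o exp_end 0)%VF = xi.
  by apply/lfunP => y; rewrite comp_lfunE exp_end0.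
by rewrite /spectral_signature => ->.
Qed.

(** The outermost exponential is absorbed into the functional, so the induction runs over all even
    functionals at once. *)
Lemma structure_group_signature g : structure_group g ->
  forall xi : 'Hom(J, R^o), even_dual xi ->
  spectral_signature beta (xi \o g)%VF = spectral_signature beta xi.
Proof.
elim=> [xi _|f h fS _ IH xi xi0]; first by rewrite comp_lfun1r.
rewrite comp_lfunA IH; first exact: exp_signature.
by apply: exp_even_dual => //; case: fS.
Qed.

End Invariance.

Theorem theorem5p3 (R : realType) (J : superalgebra R) (beta : {biscalar J})
    (J_jordan : jordan_superalgebra J) (J_unital : unital J)
    (J_beta : pseudo_euclidean beta) (J_pos : positive_even_part J)
    (xi : 'Hom(J, R^o)) (xi_even : even_dual xi) :
  forall eta1 eta2 : 'Hom(J, R^o),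
    orbit0 xi eta1 -> orbit0 xi eta2 ->
    spectral_signature beta eta1 = spectral_signature beta eta2.
Proof.
move=> eta1 eta2 [g1 G1 ->] [g2 G2 ->].
by rewrite !structure_group_signature.
Qed.
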